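(* There exist absolute constants $c_1,c_2>0$ such that every set $S$ of $n\ge 3$ points in $\mathbb{R}^3$, not all on a line, contains two points $a,b$ and a collection of at least $c_1 n^{2/3}/\beta(n)$ triangles with vertices in $S$, each having $ab$ as a side, whose areas are pairwise distinct and positive; here $\beta(n)=\exp(\alpha(n)^{c_2})$ and $\alpha$ is the inverse Ackermann function.
   Context: A triangle with vertices in $S$ is an unordered triple of points of $S$. *)

(* Defs.v *)
From HB Require Import structures.
From mathcomp Require Import all_boot all_order all_algebra finmap.
From mathcomp Require Import ring reals sequences exp.

Set Implicit Arguments.
Unset Strict Implicit.
Unset Printing Implicit Defensive.

Import Order.TTheory GRing.Theory Num.Theory.

Local Open Scope fset_scope.
Local Open Scope ring_scope.

(* The Ackermann-Peter variant. Other usual variants change the diagonal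
   inverse below only by an additive constant. *)
Fixpoint ackermann (m : nat) : nat -> nat :=
  if m is m'.+1 then
    fix ack_m (n : nat) : nat :=
      if n is n'.+1 then ackermann m' (ack_m n') else ackermann m' 1
  else succn.

Lemma ackermann_gt (m n : nat) : (n < ackermann m n)%N.
Proof.
elim: m n => [//|m IHm]; elim=> [|n IHn].
  exact: leq_ltn_trans (leq0n 1) (IHm 1%N).
exact: leq_ltn_trans IHn (IHm _).
Qed.

Lemma ackermann_diag_unbounded (n : nat) :
  exists k, (n <= ackermann k k)%N.
Proof. by exists n; apply/ltnW/ackermann_gt. Qed.

Definition inverse_ackermann (n : nat) : nat :=
  ex_minn (ackermann_diag_unbounded n).

Definition beta (R : realType) (c : R) (n : nat) : R :=
  expR ((inverse_ackermann n)%:R `^ c).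

Section Geometry.
Variable R : realType.
Local Notation point := 'rV[R]_3.

Definition collinear (S : {fset point}) : Prop :=
  exists p d : point,
    d != 0 /\ forall x, x \in S -> exists t : R, x = p + t *: d.

(* The library norm `|_| on 'rV[R]_3 is the sup norm, not this one. *)
Definition euclidean_norm (v : point) : R :=
  Num.sqrt (\sum_(i < 3) v 0 i ^+ 2).

(* Indices are taken in 'I_3, i.e. modulo 3. *)
Definition cross_product (u v : point) : point :=
  \row_(i < 3) (u 0 (i + 1) * v 0 (i + 2%:R) - u 0 (i + 2%:R) * v 0 (i + 1)).

Definition area3 (x y z : point) : R :=
  euclidean_norm (cross_product (y - x) (z - x)) / 2.

Definition triangle (S T : {fset point}) : Prop := T `<=` S /\ #|` T| = 3%N.

(* The three vertices are read off in the order in which T enumerates them;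
   by area_fset3 the value does not depend on that order. *)
Definition area (T : {fset point}) : R :=
  let s := enum_fset T in area3 s`_0 s`_1 s`_2.

Lemma area3_rot (x y z : point) : area3 y z x = area3 x y z.
Proof.
rewrite /area3; congr (euclidean_norm _ / _); apply/rowP => i.
rewrite !mxE; move: (i + 1) (i + 2%:R) => j k; ring.
Qed.

Lemma area3_swap (x y z : point) : area3 x z y = area3 x y z.
Proof.
rewrite /area3 /euclidean_norm; congr (Num.sqrt _ / _).
apply: eq_bigr => i _; rewrite !mxE; move: (i + 1) (i + 2%:R) => j k; ring.
Qed.

Lemma area_fset3 (x y z : point) :
  x != y -> x != z -> y != z -> area [fset x; y; z] = area3 x y z.
Proof.
move=> xy xz yz; rewrite /area.
have us : uniq [:: x; y; z] by rewrite /= !inE negb_or xy xz yz.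
have : perm_eq (enum_fset [fset x; y; z]) [:: x; y; z].
  by apply: uniq_perm => // u; rewrite !inE -!orbA.
move: (enum_fset _) => s ps.
have := perm_size ps; case: s ps => [|a [|b [|c [|]]]] //= ps _.
have mem u : u \in [:: x; y; z] -> [\/ u = a, u = b | u = c].
  rewrite -(perm_mem ps) !inE => /or3P[]/eqP->;
    by [constructor 1 | constructor 2 | constructor 3].
have /mem xabc : x \in [:: x; y; z] by rewrite !inE eqxx.
have /mem yabc : y \in [:: x; y; z] by rewrite !inE eqxx orbT.
have /mem zabc : z \in [:: x; y; z] by rewrite !inE eqxx !orbT.
case: xabc => ?; case: yabc => ?; case: zabc => ?; subst x y z => //;
  rewrite ?eqxx // in xy xz yz.
- exact/esym/area3_swap.
- by rewrite -[LHS]area3_rot; apply: area3_swap.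
- exact/esym/area3_rot.
- exact: area3_rot.
- by rewrite [RHS]area3_swap; apply: area3_rot.
Qed.

End Geometry.

(* Main.v *)
(* For a line [ab] the area of [abx] is proportional to the distance of [x]
   from the line, so the point set lies on few cylinders around [ab] if few
   areas occur.  Fix [a] and let [b] run over representatives [B] of the lines
   through [a]; say that at most [T] cylinders occur around each axis.

   Call two points close if few of these cylinders separate them.  By Haussler's
   packing lemma, whose shatter function is bounded by Warren's theorem on sign
   patterns of quadrics, [O(r^3)] balls of radius [1/r] of all cylinders cover
   [B].  In such a ball a point is, for most axes, within [O(T/r)] levels of the
   centre; since three points lie on at most 32 cylinders with axis through [a],
   double counting of triples shows that for [r] about [T / sqrt |B|] a ball has
   [O(sqrt |B|)] points.  Hence [|B|^2 = O(T^3)].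

   A point [a] on linearly many lines exists unless a positive proportion of the
   points is collinear: the same covering, applied to pencils of lines instead
   of families of coaxial cylinders, replaces Szemeredi-Trotter.  If many points
   are collinear, a side from one of them to a point off the line suffices.
   The argument loses no factor [beta], so [c2] is arbitrary. *)
Require Import Defs.
From mathcomp Require Import all_boot all_order all_algebra finmap zify ring lra.
From mathcomp Require Import boolp classical_sets functions reals exp topology.
From mathcomp Require Import normedtype derive.

Set Implicit Arguments.
Unset Strict Implicit.
Unset Printing Implicit Defensive.

Import Order.TTheory GRing.Theory Num.Theory.
Import numFieldNormedType.Exports.

(** * Counting over sequences *)

Local Open Scope nat_scope.

Lemma countE (T : Type) (a : pred T) (s : seq T) : count a s = \sum_(x <- s) a x.
Proof. by rewrite -sumn_count sumnE big_map. Qed.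

Lemma sum_nat_const_seq (T : Type) (s : seq T) k : \sum_(x <- s) k = size s * k.
Proof. by rewrite big_const_seq count_predT iter_addn_0 mulnC. Qed.

Lemma leq_sum_in (T : eqType) (s : seq T) (F F' : T -> nat) :
  {in s, forall x, F x <= F' x} -> \sum_(x <- s) F x <= \sum_(x <- s) F' x.
Proof. by move=> le_F; rewrite !big_seq; apply: leq_sum => x /le_F. Qed.

Lemma double_count (T U : Type) (P : T -> U -> bool) (s : seq T) (t : seq U) :
  \sum_(x <- s) count (P x) t = \sum_(y <- t) count (P^~ y) s.
Proof.
under eq_bigr => x _ do rewrite countE.
by rewrite exchange_big; apply: eq_bigr => y _; rewrite countE.
Qed.

Lemma count_predC1 (T : eqType) (s : seq T) x :
  uniq s -> x \in s -> count (predC1 x) s = (size s).-1.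
Proof. by move=> us xs; rewrite -size_filter -rem_filter // size_rem. Qed.

Lemma count_eq_uniq (T : eqType) (s : seq T) x :
  uniq s -> count (eq_op x) s = (x \in s).
Proof.
by move=> us; rewrite -count_uniq_mem //; apply: eq_count => y; apply: eq_sym.
Qed.

Lemma count_gt_markov (T : Type) (s : seq T) (F : T -> nat) h :
  h.+1 * count (fun x => h < F x) s <= \sum_(x <- s) F x.
Proof.
rewrite countE big_distrr; apply: leq_sum => x _ /=.
by case: ltnP => Fx; rewrite ?muln1 ?muln0.
Qed.

Lemma size_le_sum_cover (T U : eqType) (s : seq T) (Z : seq U) (P : U -> pred T) :
    {in s, forall x, exists2 c, c \in Z & P c x} ->
  size s <= \sum_(c <- Z) count (P c) s.
Proof.
move=> cov; rewrite double_count -[size s]muln1 -sum_nat_const_seq.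
apply: leq_sum_in => x /cov[c cZ Pcx].
by rewrite -has_count; apply/hasP; exists c.
Qed.

Lemma seq_argmax d (V : orderType d) (T : eqType) (s : seq T) (f : T -> V) :
  s != [::] -> exists2 m, m \in s & {in s, forall x, (f x <= f m)%O}.
Proof.
elim: s => // x [|y s] IHs _.
  by exists x; rewrite ?mem_head // => z; rewrite inE => /eqP->.
have [//|m ms mle] := IHs; have [xm|mx] := leP (f x) (f m).
  exists m; first by rewrite inE ms orbT.
  by move=> z; rewrite inE => /predU1P[->|/mle].
exists x; first exact: mem_head.
by move=> z; rewrite inE => /predU1P[->//|/mle zm]; apply: le_trans zm (ltW mx).
Qed.

Section Values.
Variables (T U : eqType) (f : T -> U).
Implicit Type s : seq T.

Definition values s : seq U := undup [seq f x | x <- s].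

Lemma values_uniq s : uniq (values s).
Proof. exact: undup_uniq. Qed.

Lemma mem_values s x : x \in s -> f x \in values s.
Proof. by move=> xs; rewrite mem_undup map_f. Qed.

Lemma valuesP s v : reflect (exists2 x, x \in s & v = f x) (v \in values s).
Proof. by rewrite mem_undup; apply: mapP. Qed.

Lemma big_values (R : Type) (idx : R) (op : Monoid.com_law idx) s (F : T -> R) :
  \big[op/idx]_(x <- s) F x =
  \big[op/idx]_(v <- values s) \big[op/idx]_(x <- s | f x == v) F x.
Proof.
under [RHS]eq_bigr => v _ do rewrite big_mkcond.
rewrite exchange_big; apply: eq_big_seq => x xs /=; rewrite -big_mkcond -big_filter.
under eq_filter => v do rewrite eq_sym.
by rewrite filter_pred1_uniq ?big_seq1 ?values_uniq ?mem_values.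
Qed.

Lemma sum_count_values s : \sum_(v <- values s) count (fun x => f x == v) s = size s.
Proof. by rewrite -sum1_size big_values; apply: eq_bigr => v _; rewrite sum1_count. Qed.

Lemma size_le_values s k :
  {in s, forall x, count (fun y => f y == f x) s <= k} -> size s <= size (values s) * k.
Proof.
move=> le_k; rewrite -sum_count_values -sum_nat_const_seq.
by apply: leq_sum_in => _ /valuesP[x xs ->]; apply: le_k.
Qed.

End Values.

(** * The packing lemma *)

Fixpoint cube_sum (s : nat) (w : seq bool -> nat) : nat :=
  if s is s'.+1 then
    cube_sum s' (fun v => w (false :: v)) + cube_sum s' (fun v => w (true :: v))
  else w [::].

(* Total weight of the edges of the [s]-cube, an edge weighing as much as its
   lighter end. *)
Fixpoint edge_weight (s : nat) (w : seq bool -> nat) : nat :=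
  if s is s'.+1 then
    cube_sum s' (fun v => minn (w (false :: v)) (w (true :: v)))
    + (edge_weight s' (fun v => w (false :: v))
       + edge_weight s' (fun v => w (true :: v)))
  else 0.

Definition shatters (d s : nat) (w : seq bool -> nat) : Prop :=
  exists2 J : seq nat, size J = d &
    forall u : seq bool, size u = d ->
      exists v, [/\ size v = s, 0 < w v & [seq nth false v j | j <- J] = u].

Section CubeWeights.
Implicit Types (d s k : nat) (w : seq bool -> nat).

Lemma leq_cube_sum s w w' :
  (forall v, size v = s -> w v <= w' v) -> cube_sum s w <= cube_sum s w'.
Proof.
elim: s w w' => [|s IHs] w w' le_w /=; first exact: le_w.
by apply: leq_add; apply: IHs => v sv; apply: le_w; rewrite /= sv.
Qed.

Lemma eq_cube_sum s w w' :
  (forall v, size v = s -> w v = w' v) -> cube_sum s w = cube_sum s w'.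
Proof.
by move=> e; apply/eqP; rewrite eqn_leq !leq_cube_sum // => v /e->.
Qed.

Lemma cube_sumD s w w' :
  cube_sum s (fun v => w v + w' v) = cube_sum s w + cube_sum s w'.
Proof. by elim: s w w' => [|s IHs] w w' //=; rewrite !IHs addnACA. Qed.

Lemma cube_sumM s k w : cube_sum s (fun v => k * w v) = k * cube_sum s w.
Proof. by elim: s w => [|s IHs] w //=; rewrite !IHs mulnDr. Qed.

Lemma cube_sum_big (J : Type) (I : seq J) s (w : J -> seq bool -> nat) :
  cube_sum s (fun v => \sum_(i <- I) w i v) = \sum_(i <- I) cube_sum s (w i).
Proof. by elim: s w => [|s IHs] w //=; rewrite !IHs big_split. Qed.

Lemma eq_edge_weight s w w' : w =1 w' -> edge_weight s w = edge_weight s w'.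
Proof. by move/funext->. Qed.

Lemma edge_weight_submod s w w' :
  edge_weight s w + edge_weight s w' <=
  edge_weight s (fun v => maxn (w v) (w' v))
  + edge_weight s (fun v => minn (w v) (w' v)).
Proof.
elim: s w w' => [|s IHs] w w' //=.
have := IHs (fun v => w (false :: v)) (fun v => w' (false :: v)).
have := IHs (fun v => w (true :: v)) (fun v => w' (true :: v)).
suff : cube_sum s (fun v => minn (w (false :: v)) (w (true :: v))) +
       cube_sum s (fun v => minn (w' (false :: v)) (w' (true :: v))) <=
       cube_sum s (fun v => minn (maxn (w (false :: v)) (w' (false :: v)))
                                 (maxn (w (true :: v)) (w' (true :: v)))) +
       cube_sum s (fun v => minn (minn (w (false :: v)) (w' (false :: v)))
                                 (minn (w (true :: v)) (w' (true :: v)))) by lia.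
by rewrite -!cube_sumD; apply: leq_cube_sum => v _; lia.
Qed.

Lemma shatters_pred d s w : shatters d.+1 s w -> shatters d s w.
Proof.
case=> [[|j J] //= [sJ]] sh; exists J => // u su.
have [v [sv wv [_ e]]] := sh (false :: u) (congr1 S su).
by exists v.
Qed.

Lemma shatters_max d s w :
  shatters d s (fun v => maxn (w (false :: v)) (w (true :: v))) ->
  shatters d s.+1 w.
Proof.
case=> J sJ sh; exists [seq j.+1 | j <- J]; first by rewrite size_map.
move=> u /sh[v [sv]]; rewrite leq_max => /orP[] wv e;
  [exists (false :: v) | exists (true :: v)]; split; rewrite /= ?sv //;
  by rewrite -map_comp.
Qed.

Lemma shatters_min d s w :
  shatters d s (fun v => minn (w (false :: v)) (w (true :: v))) ->
  shatters d.+1 s.+1 w.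
Proof.
case=> J sJ sh; exists (0 :: [seq j.+1 | j <- J]).
  by rewrite /= size_map sJ.
case=> [|b u] // [/sh[v [sv]]]; rewrite leq_min => /andP[w0 w1] e.
exists (b :: v); split; rewrite /= ?sv //; first by case: b.
by rewrite -map_comp; congr (_ :: _).
Qed.

Lemma cube_sum_unshattered s w : ~ shatters 0 s w -> cube_sum s w = 0.
Proof.
move=> nsh; apply/eqP; rewrite -leqn0 -(mul0n (cube_sum s w)) -cube_sumM.
apply: leq_cube_sum => v sv; rewrite mul0n leqNgt; apply/negP => wv.
by apply: nsh; exists [::] => // -[|//] _; exists v.
Qed.

(* Haussler's bound for the one-inclusion graph; taking maxima and minima of
   the two halves plays the role of projection and of the doubled part. *)
Lemma edge_weight_le d s w :
  ~ shatters d.+1 s w -> edge_weight s w <= d * cube_sum s w.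
Proof.
elim: s d w => [|s IHs] d w nsh //=.
set w0 := fun v => w (false :: v); set w1 := fun v => w (true :: v).
set wM := fun v => maxn (w0 v) (w1 v); set wm := fun v => minn (w0 v) (w1 v).
have sumE : cube_sum s w0 + cube_sum s w1 = cube_sum s wM + cube_sum s wm.
  by rewrite -!cube_sumD; apply: eq_cube_sum => v _; rewrite /wM /wm; lia.
have := edge_weight_submod s w0 w1; rewrite -/wM -/wm => sub.
have /IHs leM : ~ shatters d.+1 s wM by move/shatters_max.
have nshm : ~ shatters d s wm by move/shatters_min.
suff lighter_le : cube_sum s wm + edge_weight s wm <= d * cube_sum s wm.
  by rewrite sumE; lia.
case: d nshm {leM nsh} => [|d] nshm; last by have := IHs _ _ nshm; lia.
have : ~ shatters 1 s wm by move/shatters_pred.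
by move/IHs; rewrite (cube_sum_unshattered nshm); lia.
Qed.

End CubeWeights.

Section Packing.
Variables (X : eqType) (J : eqType) (I : seq J) (sgn : X -> J -> bool).

Definition separation (x y : X) : nat := count (fun i => sgn x i != sgn y i) I.

Definition pattern (A : seq J) (x : X) : seq bool := [seq sgn x i | i <- A].

Definition class_size (N : seq X) (A : seq J) (v : seq bool) : nat :=
  count (fun x => pattern A x == v) N.

Definition class_count (N : seq X) (A : seq J) : nat :=
  cube_sum (size A) (fun v => 0 < class_size N A v).

Definition half (N : seq X) (i : J) (b : bool) : seq X :=
  [seq x <- N | sgn x i == b].

Fixpoint sample_sum (s : nat) (F : seq J -> nat) : nat :=
  if s is s'.+1 then \sum_(i <- I) sample_sum s' (fun A => F (i :: A))
  else F [::].

Lemma mem_half N i b x : (x \in half N i b) = (sgn x i == b) && (x \in N).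
Proof. exact: mem_filter. Qed.

Lemma size_halves N i : size (half N i false) + size (half N i true) = size N.
Proof.
rewrite !size_filter -(count_predC (fun x => sgn x i)) addnC.
by congr (_ + _); apply: eq_count => x /=; case: sgn.
Qed.

Lemma class_size_cons N i A b v :
  class_size N (i :: A) (b :: v) = class_size (half N i b) A v.
Proof.
rewrite /class_size count_filter; apply: eq_count => x /=.
by rewrite eqseq_cons andbC.
Qed.

Lemma cube_sum_class_size N A : cube_sum (size A) (class_size N A) = size N.
Proof.
elim: A N => [|i A IHA] N /=.
  by rewrite /class_size /= -size_filter filter_predT.
by rewrite !(eq_cube_sum (fun v _ => class_size_cons _ _ _ _ v)) !IHA size_halves.
Qed.

Lemma class_count_cons N i A :
  class_count N (i :: A) =
  class_count (half N i false) A + class_count (half N i true) A.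
Proof.
rewrite /class_count /=; congr (_ + _); apply: eq_cube_sum => v _;
  by rewrite class_size_cons.
Qed.

Lemma leq_sample_sum s F F' :
  (forall A, size A = s -> {subset A <= I} -> F A <= F' A) ->
  sample_sum s F <= sample_sum s F'.
Proof.
elim: s F F' => [|s IHs] F F' le_F /=; first exact: le_F.
apply: leq_sum_in => i iI; apply: IHs => A sA AI.
by apply: le_F => [|j]; rewrite /= ?sA // inE => /predU1P[->|/AI].
Qed.

Lemma eq_sample_sum s F F' :
  (forall A, size A = s -> F A = F' A) -> sample_sum s F = sample_sum s F'.
Proof.
by move=> e; apply/eqP; rewrite eqn_leq !leq_sample_sum // => A /e->.
Qed.

Lemma sample_sumD s F F' :
  sample_sum s (fun A => F A + F' A) = sample_sum s F + sample_sum s F'.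
Proof.
elim: s F F' => [|s IHs] F F' //=.
by rewrite -big_split; apply: eq_bigr => i _; rewrite IHs.
Qed.

Lemma sample_sumM s k F : sample_sum s (fun A => k * F A) = k * sample_sum s F.
Proof.
by elim: s F => [|s IHs] F //=; rewrite big_distrr; apply: eq_bigr => i _.
Qed.

Lemma sample_sum_const s k : sample_sum s (fun=> k) = size I ^ s * k.
Proof.
by elim: s => [|s IHs] /=; rewrite ?mul1n // IHs sum_nat_const_seq expnS mulnA.
Qed.

Lemma sample_sum_big s (F : J -> seq J -> nat) :
  \sum_(i <- I) sample_sum s (F i) = sample_sum s (fun A => \sum_(i <- I) F i A).
Proof.
elim: s F => [|s IHs] F //=.
by rewrite exchange_big; apply: eq_bigr => i _; rewrite IHs.
Qed.

Lemma sum_separated_pairs N i :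
  \sum_(x <- N) count (fun y => sgn x i != sgn y i) N =
  2 * (size (half N i false) * size (half N i true)).
Proof.
have sizeE b : count (fun y => b != sgn y i) N = size (half N i (~~ b)).
  by rewrite size_filter; apply: eq_count => y; case: b; case: sgn.
rewrite (eq_bigr _ (fun x _ => sizeE (sgn x i))).
rewrite (bigID (fun x => sgn x i == false)) /=.
rewrite (eq_bigr (fun=> size (half N i true))); last by move=> x /eqP->.
rewrite [X in _ + X](eq_bigr (fun=> size (half N i false))); last first.
  by move=> x; case: sgn.
have -> : \sum_(x <- N | sgn x i != false) size (half N i false) =
    \sum_(x <- N | sgn x i == true) size (half N i false).
  by apply: eq_bigl => x; case: sgn.
rewrite !big_const_seq !iter_addn_0 -!size_filter -!/(half N i _).
by rewrite [in LHS]mulnC mul2n -addnn.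
Qed.

Variable r : nat.

Definition well_separated (N : seq X) : Prop :=
  {in N &, forall x y, x != y -> size I <= r * separation x y}.

Lemma well_separated_filter N (p : pred X) :
  well_separated N -> well_separated [seq x <- N | p x].
Proof.
by move=> sepN x y /(mem_subseq (filter_subseq _ _)) xN
  /(mem_subseq (filter_subseq _ _)) yN; apply: sepN.
Qed.

Lemma well_separated_pairs N : uniq N -> well_separated N ->
  size I * (size N * (size N).-1) <=
  r * \sum_(i <- I) \sum_(x <- N) count (fun y => sgn x i != sgn y i) N.
Proof.
move=> uN sepN; rewrite exchange_big.
under [in leqRHS]eq_bigr => x _ do rewrite double_count.
rewrite mulnCA -sum_nat_const_seq big_distrr /=; apply: leq_sum_in => x xN.
rewrite -(count_predC1 uN xN) countE !big_distrr; apply: leq_sum_in => y yN /=.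
have [->|yx] := eqVneq y x; first by rewrite muln0.
by rewrite muln1 sepN // eq_sym.
Qed.

Lemma well_separated_halves N : uniq N -> well_separated N ->
  size I * size N <=
  2 * r * (\sum_(i <- I) minn (size (half N i false)) (size (half N i true)))
  + size I * (0 < size N).
Proof.
move=> uN sepN; have [->|N0] := posnP (size N); first by rewrite !muln0.
have pairs_le i : \sum_(x <- N) count (fun y => sgn x i != sgn y i) N <=
    2 * size N * minn (size (half N i false)) (size (half N i true)).
  rewrite sum_separated_pairs -(size_halves N i).
  by move: (size (half N i false)) (size (half N i true)) => a b; case: leqP; nia.
have : size I * (size N * (size N).-1) <=
    2 * r * (\sum_(i <- I) minn (size (half N i false)) (size (half N i true)))
    * size N.
  apply: leq_trans (well_separated_pairs uN sepN) _.
  set M := \sum_(i <- I) minn _ _.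
  have -> : 2 * r * M * size N = r * (2 * size N * M) by lia.
  rewrite leq_mul2l big_distrr; apply/orP; right.
  by apply: leq_sum => i _; apply: pairs_le.
rewrite mulnCA mulnC leq_pmul2r // muln1 => le_min.
by rewrite -{1}(prednK N0) mulnS addnC leq_add2r.
Qed.

Lemma sampled_halves_lb s N : uniq N -> well_separated N ->
  size I ^ s.+1 * size N <=
  2 * r * (\sum_(i <- I) sample_sum s (fun A => cube_sum s (fun v =>
     minn (class_size N (i :: A) (false :: v)) (class_size N (i :: A) (true :: v)))))
  + size I * sample_sum s (class_count N).
Proof.
move=> uN sepN.
rewrite sample_sum_big -!sample_sumM -sample_sumD expnSr -mulnA -sample_sum_const.
apply: leq_sample_sum => A sA _.
rewrite /class_count sA -cube_sum_big -!cube_sumM -cube_sumD.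
rewrite -[in leqLHS](cube_sum_class_size N A) sA -cube_sumM.
apply: leq_cube_sum => v sv; pose Nv := [seq x <- N | pattern A x == v].
have halfE i b : class_size N (i :: A) (b :: v) = size (half Nv i b).
  rewrite class_size_cons !size_filter /class_size !count_filter.
  by apply: eq_count => x /=; rewrite andbC.
have -> : class_size N A v = size Nv by rewrite size_filter.
under eq_bigr => i _ do rewrite !halfE.
exact: well_separated_halves (filter_uniq _ uN) (well_separated_filter sepN).
Qed.

Lemma sample_edge_weight_split s N :
  sample_sum s.+1 (fun A => edge_weight s.+1 (class_size N A)) =
  \sum_(i <- I) sample_sum s (fun A => cube_sum s (fun v =>
     minn (class_size N (i :: A) (false :: v)) (class_size N (i :: A) (true :: v))))
  + \sum_(i <- I) (sample_sum s (fun A => edge_weight s (class_size (half N i false) A))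
     + sample_sum s (fun A => edge_weight s (class_size (half N i true) A))).
Proof.
rewrite -big_split /=; apply: eq_bigr => i _; rewrite -!sample_sumD.
apply: eq_sample_sum => A _ /=; congr (_ + (_ + _));
  by apply: eq_edge_weight => v; rewrite class_size_cons.
Qed.

(* The expected number of edges of the one-inclusion graph of a random sample:
   the edges in the direction of the first sampled index are bounded from below
   directly, the other ones by induction on both halves. *)
Lemma sample_edge_weight_lb s N : uniq N -> well_separated N ->
  s * (size I ^ s * size N) <=
  2 * r * sample_sum s (fun A => edge_weight s (class_size N A))
  + s * size I * sample_sum s.-1 (class_count N).
Proof.
elim: s N => [|s IHs] N uN sepN //.
pose sub i := sample_sum s (fun A => edge_weight s (class_size (half N i false) A))
  + sample_sum s (fun A => edge_weight s (class_size (half N i true) A)).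
pose cls i := sample_sum s.-1 (class_count (half N i false))
  + sample_sum s.-1 (class_count (half N i true)).
have halves_lb i :
    s * (size I ^ s * size N) <= 2 * r * sub i + s * size I * cls i.
  have halfP b := IHs (half N i b) (filter_uniq _ uN) (well_separated_filter sepN).
  have := (halfP false, halfP true); rewrite -(size_halves N i) !mulnDr.
  by move=> [lb0 lb1]; apply: leq_trans (leq_add lb0 lb1) _; rewrite addnACA.
have sum_cls : s * size I * \sum_(i <- I) cls i =
    s * size I * sample_sum s (class_count N).
  have [->//|s0] := posnP s; congr (_ * _); rewrite -[in RHS](prednK s0).
  apply: eq_bigr => i _.
  by rewrite /cls -sample_sumD; apply: eq_sample_sum => A _; rewrite class_count_cons.
have : size I * (s * (size I ^ s * size N)) <=
    2 * r * (\sum_(i <- I) sub i) + s * size I * sample_sum s (class_count N).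
  rewrite -sum_cls !big_distrr -big_split /= -sum_nat_const_seq.
  exact: leq_sum (fun i _ => halves_lb i).
move: (sampled_halves_lb s uN sepN); rewrite sample_edge_weight_split expnS /=.
by rewrite -[\sum_(i <- I) (_ + _)]/(\sum_(i <- I) sub i); lia.
Qed.

Lemma packing_bound d s K N : 0 < size I -> 0 < d ->
    uniq N -> well_separated N -> s.+1 = 4 * d * r ->
    (forall A, {subset A <= I} -> ~ shatters d.+1 (size A) (class_size N A)) ->
    (forall A, size A = s -> {subset A <= I} -> class_count N A <= K) ->
  size N <= 2 * K.
Proof.
move=> I0 d0 uN sepN sE nsh leK.
have edges_le : sample_sum s.+1 (fun A => edge_weight s.+1 (class_size N A)) <=
    size I ^ s.+1 * (d * size N).
  rewrite -sample_sum_const; apply: leq_sample_sum => A sA AI.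
  by rewrite -[in leqRHS](cube_sum_class_size N A) -sA; apply/edge_weight_le/nsh.
have classes_le : sample_sum s (class_count N) <= size I ^ s * K.
  by rewrite -sample_sum_const; apply: leq_sample_sum => A sA AI; apply: leK.
have : s.+1 * (size I ^ s.+1 * size N) <=
    2 * r * (size I ^ s.+1 * (d * size N)) + s.+1 * size I * (size I ^ s * K).
  apply: leq_trans (sample_edge_weight_lb s.+1 uN sepN) _.
  by apply: leq_add; rewrite leq_mul2l ?edges_le ?classes_le orbT.
have -> : s.+1 * size I * (size I ^ s * K) = s.+1 * (size I ^ s.+1 * K).
  by rewrite expnS -!mulnA; congr (_ * _).
have q0 : 0 < size I ^ s.+1 by rewrite expn_gt0 I0.
rewrite sE; move: (size I ^ s.+1) q0 => q q0 count_le.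
have r0 : 0 < r by case: (r) sE => //; rewrite muln0.
have c0 : 0 < 2 * d * r * q by rewrite !muln_gt0 d0 r0.
by rewrite -(leq_pmul2l c0); nia.
Qed.

Lemma maximal_well_separated (N : seq X) : exists Z : seq X,
  [/\ uniq Z, {subset Z <= N}, well_separated Z &
      forall x, x \in N -> exists2 c, c \in Z & r * separation x c <= size I].
Proof.
elim: N => [|x N [Z [uZ ZN sepZ cov]]]; first by exists [::].
have sepC y z : separation y z = separation z y.
  by apply: eq_count => i; rewrite eq_sym.
have sepxx : separation x x = 0.
  by rewrite /separation (eq_count (a2 := pred0)) ?count_pred0 // => i /=; rewrite eqxx.
have [/hasP[c cZ cx]|/hasPn far] :=
  boolP (has (fun c => r * separation x c <= size I) Z).
  exists Z; split=> //= y; first by rewrite inE => /ZN->; rewrite orbT.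
  by rewrite inE => /predU1P[->|/cov //]; exists c.
exists (x :: Z); split=> /=.
- by rewrite uZ andbT; apply/negP => /far; rewrite sepxx muln0.
- by move=> y; rewrite !inE => /predU1P[->|/ZN->]; rewrite ?eqxx ?orbT.
- move=> y z; rewrite !inE => /predU1P[->|yZ] /predU1P[->|zZ].
  + by rewrite eqxx.
  + by have := far _ zZ; rewrite -ltnNge => /ltnW.
  + by have := far _ yZ; rewrite -ltnNge sepC => /ltnW.
  + exact: sepZ.
- move=> y; rewrite inE => /predU1P[->|/cov[c cZ cy]].
    by exists x; rewrite ?mem_head // sepxx muln0.
  by exists c; rewrite // inE cZ orbT.
Qed.

Lemma class_count_reps N A : exists N' : seq X,
  [/\ {subset N' <= N}, size N' = class_count N A &
      uniq [seq pattern A x | x <- N']].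
Proof.
elim: A N => [|i A IHA] N.
  case: N => [|x N]; first by exists [::].
  by exists [:: x]; split=> // y; rewrite !inE => /eqP->; rewrite eqxx.
have [N0 [sub0 size0 uniq0]] := IHA (half N i false).
have [N1 [sub1 size1 uniq1]] := IHA (half N i true).
have half0 x : x \in N0 -> sgn x i = false /\ x \in N.
  by move/sub0; rewrite mem_half => /andP[/eqP].
have half1 x : x \in N1 -> sgn x i = true /\ x \in N.
  by move/sub1; rewrite mem_half => /andP[/eqP].
exists (N0 ++ N1); split.
- by move=> x; rewrite mem_cat => /orP[/half0[]|/half1[]].
- by rewrite size_cat class_count_cons size0 size1.
have consE b (M : seq X) : (forall x, x \in M -> sgn x i = b) ->
    [seq pattern (i :: A) x | x <- M] = [seq b :: v | v <- [seq pattern A x | x <- M]].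
  by move=> Mb; rewrite -map_comp; apply/eq_in_map => x /Mb /= ->.
rewrite map_cat cat_uniq (consE false) => [|x /half0[] //].
rewrite (consE true) => [|x /half1[] //].
have cons_inj b : injective (cons b : seq bool -> seq bool) by move=> u v [].
rewrite !(map_inj_uniq (cons_inj _)) uniq0 uniq1 andbT /=.
by apply/hasPn => _ /mapP[v _ ->]; apply/mapP => -[].
Qed.

Lemma shatters_reps d N A : shatters d.+1 (size A) (class_size N A) ->
  exists (A' : seq J) (N' : seq X), [/\ size A' = d.+1, {subset A' <= A},
    {subset N' <= N}, size N' = 2 ^ d.+1 & uniq [seq pattern A' x | x <- N']].
Proof.
case=> P sP sh.
have in_range j : j \in P -> j < size A.
  have [v [sv _ e]] := sh (nseq d.+1 true) (size_nseq _ _).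
  move=> jP; rewrite -sv ltnNge; apply/negP => /(nth_default false) vj.
  have : nth false v j \in nseq d.+1 true by rewrite -e; apply: map_f.
  by rewrite vj mem_nseq.
have [j0 _] : exists2 j0, j0 \in A & true.
  case: (P) sP in_range => // j P' _ /(_ j (mem_head _ _)).
  by case: (A) => // j0 A' _; exists j0; rewrite ?mem_head.
pose A' := [seq nth j0 A j | j <- P].
have reps (u : d.+1.-tuple bool) : exists x, x \in N /\ pattern A' x = u.
  have [v [sv]] := sh u (size_tuple u).
  rewrite /class_size -has_count => /hasP[x xN /eqP xv] e.
  exists x; split=> //; rewrite -e -xv /pattern -!map_comp.
  by apply/eq_in_map => j /in_range jA /=; rewrite (nth_map j0).
have [f fP] := choice reps.
exists A', [seq f u | u : d.+1.-tuple bool]; split.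
- by rewrite size_map.
- by move=> _ /mapP[j /in_range jA ->]; apply: mem_nth.
- by move=> _ /codomP[u ->]; have [] := fP u.
- by rewrite size_codom card_tuple card_bool.
- rewrite -map_comp (_ : [seq _ | u <- _] = [seq val u | u <- enum {: d.+1.-tuple bool}]).
    by rewrite (map_inj_uniq val_inj) enum_uniq.
  by apply/eq_map => u /=; have [_ ->] := fP u.
Qed.

End Packing.

(** * Polynomial functions *)

Local Open Scope ring_scope.

Section PolyFun.
Variables (R : realType) (n : nat).
Local Notation point := 'rV[R]_n.
Implicit Types (f g : point -> R) (x y : point).

Inductive poly_fun : nat -> (point -> R) -> Prop :=
| poly_fun_cst d a : poly_fun d (fun=> a)
| poly_funD d f g :
    poly_fun d f -> poly_fun d g -> poly_fun d (fun x => f x + g x)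
| poly_fun_coordM d f i : poly_fun d f -> poly_fun d.+1 (fun x => x 0 i * f x).

Lemma eq_poly_fun d f g : f =1 g -> poly_fun d f -> poly_fun d g.
Proof. by move/funext->. Qed.

Lemma poly_funW d e f : (d <= e)%N -> poly_fun d f -> poly_fun e f.
Proof.
move=> de pf; elim: pf e de => {d f} [d a|d f g _ IHf _ IHg|d f i _ IHf] e de.
- exact: poly_fun_cst.
- by apply: poly_funD; [apply: IHf|apply: IHg].
- by case: e de => // e de; apply/poly_fun_coordM/IHf.
Qed.

Lemma poly_funZ d f a : poly_fun d f -> poly_fun d (fun x => a * f x).
Proof.
elim=> {d f} [d b|d f g _ IHf _ IHg|d f i _ IHf]; first exact: poly_fun_cst.
  by apply: eq_poly_fun (poly_funD IHf IHg) => x; rewrite mulrDr.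
by apply: eq_poly_fun (poly_fun_coordM i IHf) => x; rewrite mulrCA.
Qed.

Lemma poly_funM d e f g :
  poly_fun d f -> poly_fun e g -> poly_fun (d + e) (fun x => f x * g x).
Proof.
move=> pf pg; elim: pf => {d f} [d a|d f h _ IHf _ IHh|d f i _ IHf].
- by apply: poly_funW (leq_addl d e) _; apply: poly_funZ.
- by apply: eq_poly_fun (poly_funD IHf IHh) => x; rewrite mulrDl.
- by apply: eq_poly_fun (poly_fun_coordM i IHf) => x; rewrite mulrA.
Qed.

Lemma poly_fun_coord i : poly_fun 1 (fun x => x 0 i).
Proof.
by apply: eq_poly_fun (poly_fun_coordM i (poly_fun_cst 0 1)) => x; rewrite mulr1.
Qed.

Lemma poly_funX d f k : poly_fun d f -> poly_fun (k * d) (fun x => f x ^+ k).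
Proof.
move=> pf; elim: k => [|k IHk]; first by rewrite mul0n; apply: poly_fun_cst.
by apply: eq_poly_fun (poly_funM pf IHk) => x; rewrite exprS.
Qed.

Lemma poly_fun_prod (J : Type) (A : seq J) (P : pred J) (d : J -> nat)
    (f : J -> point -> R) : (forall j, poly_fun (d j) (f j)) ->
  poly_fun (\sum_(j <- A | P j) d j) (fun x => \prod_(j <- A | P j) f j x).
Proof.
move=> pf; elim: A => [|j A IHA].
  by rewrite big_nil; apply: eq_poly_fun (poly_fun_cst 0 1) => x; rewrite big_nil.
rewrite big_cons; case Pj : (P j); last first.
  by apply: eq_poly_fun IHA => x; rewrite big_cons Pj.
by apply: eq_poly_fun (poly_funM (pf j) IHA) => x; rewrite big_cons Pj.
Qed.

Lemma poly_fun_sum (J : Type) (A : seq J) d (f : J -> point -> R) :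
  (forall j, poly_fun d (f j)) -> poly_fun d (fun x => \sum_(j <- A) f j x).
Proof.
move=> pf; elim: A => [|j A IHA].
  by apply: eq_poly_fun (poly_fun_cst d 0) => x; rewrite big_nil.
by apply: eq_poly_fun (poly_funD (pf j) IHA) => x; rewrite big_cons.
Qed.

Lemma poly_fun_continuous d f : poly_fun d f -> continuous f.
Proof.
elim=> {d f} [d a|d f g _ cf _ cg|d f i _ cf] x.
- exact: cst_continuous.
- by apply: continuousD; [apply: cf|apply: cg].
- by apply: continuousM; [apply: coord_continuous|apply: cf].
Qed.

Lemma is_derive_coord (x v : point) i : is_derive x v (fun y => y 0 i) (v 0 i).
Proof.
apply: DeriveDef; first exact/diff_derivable/differentiable_coord.
apply/lim_near_cst => //; near=> h.
have h0 : h != 0 by near: h; apply: nbhs_dnbhs_neq.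
by rewrite /= !mxE addrK scalerA mulVf // scale1r.
Unshelve. all: by end_near. Qed.

Lemma is_derive_power_sum d (x : point) i :
  is_derive x (delta_mx 0 i) (fun y : point => \sum_j y 0 j ^+ d)
    (d%:R * x 0 i ^+ d.-1).
Proof.
have := is_derive_sum (fun j => is_deriveX d (is_derive_coord x (delta_mx 0 i) j)).
rewrite [X in is_derive _ _ X _](_ : _ = fun y : point => \sum_j y 0 j ^+ d); last first.
  by apply/funext => y; rewrite fct_sumE; apply: eq_bigr => j _; rewrite fctE.
move/is_derive_eq; apply; rewrite (bigD1 i) //= mxE !eqxx big1 ?addr0 => [|j ji].
  exact: mulr1.
by rewrite mxE (negbTE ji) andbF scaler0.
Qed.

Lemma poly_fun_derive d f (v : point) : poly_fun d f ->
  exists2 g, poly_fun d g & forall x, is_derive x v f (g x).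
Proof.
elim=> {d f} [d a|d f g _ [f' pf' df] _ [g' pg' dg]|d f i pf [f' pf' df]].
- by exists (fun=> 0); [apply: poly_fun_cst|move=> x; apply: is_derive_cst].
- exists (fun x => f' x + g' x); first exact: poly_funD.
  by move=> x; apply: is_deriveD (df x) (dg x).
exists (fun x => x 0 i * f' x + v 0 i * f x).
  apply: poly_funD; first exact: poly_fun_coordM.
  by apply: poly_funZ; apply: poly_funW pf.
move=> x; apply: is_derive_eq (is_deriveM (is_derive_coord x v i) (df x)) _.
by congr (_ + _); rewrite /= mulrC.
Qed.

Lemma coord_le_norm x i : `|x 0 i| <= `|x|.
Proof.
rewrite [leRHS]/Num.Def.normr /= mx_normrE.
exact: (le_bigmax _ (fun ij : 'I_1 * 'I_n => `|x ij.1 ij.2|) (0, i)).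
Qed.

Lemma poly_fun_growth d f : poly_fun d f ->
  exists2 C, 0 <= C & forall x, 1 <= `|x| -> `|f x| <= C * `|x| ^+ d.
Proof.
elim=> {d f} [d a|d f g _ [C C0 fC] _ [C' C0' gC]|d f i _ [C C0 fC]].
- by exists `|a| => // x x1; rewrite ler_peMr // exprn_ege1.
- exists (C + C'); first exact: addr_ge0.
  move=> x x1; rewrite mulrDl; apply: le_trans (ler_normD _ _) _.
  by apply: lerD; [apply: fC|apply: gC].
- exists C => // x x1; rewrite normrM exprS mulrCA.
  by apply: ler_pM => //; [apply: coord_le_norm|apply: fC].
Qed.

Lemma poly_fun_dominated d f eps : poly_fun d f -> ~~ odd d -> 0 < eps ->
  exists rho, forall x, rho <= `|x| -> f x <= eps * \sum_i x 0 i ^+ d.+2.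
Proof.
move=> pf ev eps0; have [C C0 fC] := poly_fun_growth pf.
exists (1 + C / eps) => x xrho.
have Ce0 : 0 <= C / eps by rewrite divr_ge0 // ltW.
have x1 : 1 <= `|x| by apply: le_trans xrho; rewrite lerDl.
have x0 : 0 <= `|x| := normr_ge0 x.
have [[i0 i] /= xi] : exists i, `|x| = `|x i.1 i.2|.
  by apply: mx_norm_neq0; apply: contraTneq x1 => e; rewrite -ltNge [ `|x| ]e ltr01.
rewrite [i0]ord1 in xi.
have pow_ge0 (t : R) : 0 <= t ^+ d.+2 by rewrite exprn_even_ge0 //= negbK.
apply: (@le_trans _ _ (eps * `|x| ^+ d.+2)); last first.
  rewrite ler_pM2l // xi -normrX ger0_norm // (bigD1 i) //= lerDl.
  by apply: sumr_ge0.
apply: le_trans (ler_norm _) _; apply: le_trans (fC x x1) _.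
rewrite 2!exprS !mulrA ler_wpM2r ?exprn_ge0 //.
apply: (@le_trans _ _ (eps * `|x|)); last by rewrite ler_peMr // mulr_ge0 // ltW.
by rewrite mulrC -ler_pdivrMr //; apply: le_trans xrho; rewrite lerDr.
Qed.

End PolyFun.

(** * Systems [x_i ^+ q = h_i x] with [h_i] of degree below [q] *)

Lemma size_le_card_interpolating (F : fieldType) (X : eqType) (T : finType)
    (b : T -> X -> F) (zs : seq X) : uniq zs ->
    {in zs, forall z0, exists c : T -> F,
      {in zs, forall z, \sum_t c t * b t z = (z == z0)%:R}} ->
  (size zs <= #|T|)%N.
Proof.
move=> uzs interp; pose z (j : 'I_(size zs)) := tnth (in_tuple zs) j.
have z_in j : z j \in zs by apply: mem_tnth.
have z_inj : injective z by apply/tuple_uniqP.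
have [c cE] := choice (fun j => interp (z j) (z_in j)).
pose E : 'M[F]_(#|T|, size zs) := \matrix_(k, j) b (enum_val k) (z j).
pose B : 'M[F]_(size zs, #|T|) := \matrix_(j, k) c j (enum_val k).
have BE : B *m E = 1%:M.
  apply/matrixP => j0 j; rewrite !mxE eq_sym -(inj_eq z_inj) -cE //.
  rewrite (reindex (@enum_val _ (mem T))) /=; last first.
    by exists enum_rank => k _; rewrite ?enum_valK ?enum_rankK.
  by apply: eq_big => k; rewrite ?inE ?mxE.
have /eqP <- : row_full E by apply/row_fullP; exists B.
exact: rank_leq_row.
Qed.

Section PowerSystems.
Variables (R : realType) (n : nat).
Local Notation point := 'rV[R]_n.

Lemma poly_fun_interpolation (zs : seq point) z0 :
  exists d, exists2 f : point -> R, poly_fun d f &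
    {in zs, forall z, f z = (z == z0)%:R}.
Proof.
have separate (w : point) : exists l : point -> R,
    [/\ poly_fun 1 l, l z0 = 1 & w != z0 -> l w = 0].
  have [_|wz0] := eqVneq w z0.
    by exists (fun=> 1); split=> //; apply: poly_fun_cst.
  have /rV0Pn[i] : z0 - w != 0 by rewrite subr_eq0 eq_sym.
  rewrite !mxE => zwi; exists (fun x => (z0 0 i - w 0 i)^-1 * (x 0 i + - w 0 i)).
  split; rewrite ?mulVf ?subrr ?mulr0 //.
  by apply/poly_funZ/poly_funD; [apply: poly_fun_coord|apply: poly_fun_cst].
have [l lP] := choice separate.
have pl w : poly_fun 1 (l w) by have [] := lP w.
exists (\sum_(w <- zs | w != z0) 1)%N, (fun x => \prod_(w <- zs | w != z0) l w x).
  exact: poly_fun_prod.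
move=> z zzs; have [->|zz0] := eqVneq z z0.
  by rewrite big1 // => w _; have [] := lP w.
rewrite (big_rem z) //= zz0; have [_ _ ->] := lP z => //.
by rewrite mul0r.
Qed.

Variables (q : nat) (zs : seq point) (h : 'I_n -> point -> R).
Hypothesis q_gt0 : (0 < q)%N.
Hypothesis poly_h : forall i, poly_fun q.-1 (h i).
Hypothesis zs_pow : forall i z, z \in zs -> z 0 i ^+ q = h i z.

Local Notation exponent := {ffun 'I_n -> 'I_q}.
Implicit Types (al be : exponent) (f g : point -> R).

Definition monomial al (x : point) : R := \prod_(i < n) x 0 i ^+ al i.

Definition mdegree al : nat := (\sum_(i < n) al i)%N.

Definition reducible (d : nat) f : Prop :=
  exists2 c : exponent -> R, (forall al, (d < mdegree al)%N -> c al = 0) &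
    {in zs, forall z, f z = \sum_al c al * monomial al z}.

Lemma reducibleW d e f : (d <= e)%N -> reducible d f -> reducible e f.
Proof. by move=> de [c c0 fE]; exists c => // al /(leq_ltn_trans de)/c0. Qed.

Lemma eq_in_reducible d f g : {in zs, f =1 g} -> reducible d f -> reducible d g.
Proof. by move=> fg [c c0 fE]; exists c => // z zz; rewrite -fg // fE. Qed.

Lemma reducible0 d : reducible d (fun=> 0).
Proof. by exists (fun=> 0) => // z _; rewrite big1 // => al _; rewrite mul0r. Qed.

Lemma reducibleD d f g :
  reducible d f -> reducible d g -> reducible d (fun x => f x + g x).
Proof.
move=> [c c0 fE] [c' c0' gE]; exists (fun al => c al + c' al) => [al dal|z zz].
  by rewrite c0 // c0' // addr0.
by rewrite fE // gE // -big_split; apply: eq_bigr => al _; rewrite mulrDl.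
Qed.

Lemma reducibleZ d f a : reducible d f -> reducible d (fun x => a * f x).
Proof.
move=> [c c0 fE]; exists (fun al => a * c al) => [al dal|z zz].
  by rewrite c0 // mulr0.
by rewrite fE // big_distrr; apply: eq_bigr => al _; rewrite /= mulrA.
Qed.

Lemma reducible_sum (J : Type) (A : seq J) d (f : J -> point -> R) :
  (forall j, reducible d (f j)) -> reducible d (fun x => \sum_(j <- A) f j x).
Proof.
move=> rf; elim: A => [|j A IHA].
  by apply: eq_in_reducible (reducible0 d) => x _; rewrite big_nil.
by apply: eq_in_reducible (reducibleD (rf j) IHA) => x _; rewrite big_cons.
Qed.

Lemma reducible_monomial al : reducible (mdegree al) (monomial al).
Proof.
exists (fun be => (be == al)%:R) => [be|z _].
  by case: eqP => // ->; rewrite ltnn.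
rewrite (bigD1 al) //= eqxx mul1r big1 ?addr0 // => be /negbTE->.
by rewrite mul0r.
Qed.

Lemma monomialD1 al i x :
  monomial al x = x 0 i ^+ al i * \prod_(j < n | j != i) x 0 j ^+ al j.
Proof. exact: bigD1. Qed.

Lemma mdegreeD1 al i : mdegree al = (al i + \sum_(j < n | j != i) al j)%N.
Proof. exact: bigD1. Qed.

(* If [x_i] already occurs to the power [q - 1], the product is replaced by
   [h_i] times the other factors, which has smaller degree. *)
Lemma reducible_coordM_monomial al i :
    (forall f, poly_fun (mdegree al) f -> reducible (mdegree al) f) ->
  reducible (mdegree al).+1 (fun x => x 0 i * monomial al x).
Proof.
move=> reduce; have [al_lt|al_ge] := ltnP (al i).+1 q.
  pose be : exponent := [ffun j => if j == i then Ordinal al_lt else al j].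
  have bei : be i = (al i).+1 :> nat by rewrite ffunE eqxx.
  have bej j : j != i -> be j = al j by rewrite ffunE => /negbTE->.
  have <- : mdegree be = (mdegree al).+1.
    rewrite (mdegreeD1 be i) (mdegreeD1 al i) bei addSn.
    by congr (_ + _).+1; apply: eq_bigr => j /bej->.
  apply: eq_in_reducible (reducible_monomial be) => x _.
  rewrite (monomialD1 be i) (monomialD1 al i) bei exprS mulrA.
  by congr (_ * _); apply: eq_bigr => j /bej->.
have al_max : (al i).+1 = q by apply/eqP; rewrite eqn_leq al_ge ltn_ord.
have pow_coord j : poly_fun (al j) (fun x : point => x 0 j ^+ al j).
  by rewrite -[X in poly_fun X]muln1; apply/poly_funX/poly_fun_coord.
have /reduce/(reducibleW (leqnSn _)) : poly_fun (mdegree al)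
    (fun x => h i x * \prod_(j < n | j != i) x 0 j ^+ al j).
  have -> : mdegree al = (q.-1 + \sum_(j < n | j != i) al j)%N.
    by rewrite (mdegreeD1 al i) (congr1 predn al_max : al i = q.-1 :> nat).
  exact: poly_funM (poly_h i) (poly_fun_prod _ _ pow_coord).
apply: eq_in_reducible => z zz.
by rewrite (monomialD1 al i) -zs_pow // mulrA -exprS al_max.
Qed.

Lemma poly_fun_reducible d f : poly_fun d f -> reducible d f.
Proof.
elim/ltn_ind: d f => d IHd f pf; elim: pf IHd => {d f}.
- move=> d a _; pose o : exponent := [ffun=> Ordinal q_gt0].
  have o0 : mdegree o = 0 by rewrite /mdegree big1 // => i _; rewrite ffunE.
  have := reducibleZ a (reducible_monomial o); rewrite o0.
  move/(reducibleW (leq0n d)); apply: eq_in_reducible => x _.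
  by rewrite /monomial big1 ?mulr1 // => i _; rewrite ffunE expr0.
- move=> d f g _ IHf _ IHg IHd.
  by apply: reducibleD; [apply: IHf|apply: IHg] => e; apply: IHd.
- move=> d f i pf _ IHd; have [c c0 fE] := IHd d (ltnSn d) f pf.
  suff : reducible d.+1 (fun x => \sum_al c al * (x 0 i * monomial al x)).
    apply: eq_in_reducible => z zz; rewrite fE // big_distrr.
    by apply: eq_bigr => al _; apply: mulrCA.
  apply: reducible_sum => al; have [al_d|/c0->] := leqP (mdegree al) d; last first.
    by apply: eq_in_reducible (reducible0 _) => x _; rewrite mul0r.
  apply/reducibleZ/(@reducibleW (mdegree al).+1) => //.
  by apply: reducible_coordM_monomial => g; apply: IHd.
Qed.

Lemma power_system_roots_le : uniq zs -> (size zs <= q ^ n)%N.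
Proof.
move=> uzs; rewrite -[leqRHS](_ : #|{: exponent}| = _); last first.
  by rewrite card_ffun !card_ord.
apply: (size_le_card_interpolating (b := monomial)) => // z0 _.
have [d [f pf fE]] := poly_fun_interpolation zs z0.
have [c _ cE] := poly_fun_reducible pf.
by exists c => z zz; rewrite -cE // fE.
Qed.

End PowerSystems.

(** * Sign patterns of polynomials *)

Section LocalMinima.
Variables (R : realType) (V : normedModType R).
Implicit Types (f : V -> R) (x y v : V).

Lemma is_derive_line f x v (t : R) df :
  is_derive (t *: v + x) v f df -> is_derive t 1 (fun h : R => f (h *: v + x)) df.
Proof.
case=> fD fE.
have quotE : (fun h : R => h^-1 *: (((fun s : R => f (s *: v + x)) \o shift t) (h *: 1)
      - f (t *: v + x))) =
    (fun h => h^-1 *: ((f \o shift (t *: v + x)) (h *: v) - f (t *: v + x))).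
  by apply/funext => h; rewrite /= [h *: 1]mulr1 scalerDl addrA.
by split; [rewrite /derivable quotE|rewrite -fE /derive quotE].
Qed.

Lemma derive_near_min f x v :
    (forall y, derivable f y v) -> (\forall y \near x, f x <= f y) ->
  'D_v f x = 0.
Proof.
move=> fD xmin; pose line (h : R) := h *: v + x.
have line0 : line 0 = x by rewrite /line scale0r add0r.
have line_cvg : (line h @[h --> (0 : R)] --> x)%classic.
  rewrite -[X in (_ --> X)%classic]line0; apply: cvgD; last exact: cvg_cst.
  by apply: cvgZ; [apply: cvg_id|apply: cvg_cst].
have /nbhs_ballP[e /= e0 emin] := line_cvg _ xmin.
have lineD t : is_derive t (1 : R) (f \o line) ('D_v f (line t)).
  by apply: is_derive_line; apply: derivableP.
have [_ ] : is_derive (0 : R) 1 (f \o line) 0.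
  apply: (@derive1_at_min _ _ (- e) e) => [|t _||t].
  - by rewrite ltW // gtrN.
  - by have [] := lineD t.
  - by rewrite in_itv /= oppr_lt0 e0.
  rewrite in_itv /= -ltr_norml => te; rewrite /comp line0.
  by apply: emin; rewrite /ball /= sub0r normrN.
by have [_ ->] := lineD 0; rewrite line0.
Qed.

End LocalMinima.

Section SignConditions.
Variables (R : realType) (T : topologicalType) (J : Type).
Variables (A : seq J) (f : J -> T -> R).
Hypothesis f_cont : forall j, continuous (f j).

Lemma closed_all_ge0 : closed [set x | all (fun j => 0 <= f j x) A]%classic.
Proof.
elim: A => [|j B IHB] /=.
  by rewrite (_ : mkset _ = setT); [apply: closedT | apply/seteqP; split].
rewrite (_ : mkset _ = (f j @^-1` [set t | 0 <= t] `&`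
    [set x | all (fun j => 0 <= f j x) B])%classic); last first.
  by apply/seteqP; split=> x /=; [move/andP|move=> [? ?]; apply/andP].
apply: closedI => //; apply: preimage_closed; last exact: closed_ge.
by move=> x _; apply: f_cont.
Qed.

Lemma near_all_gt0 x : all (fun j => 0 < f j x) A ->
  \forall y \near x, all (fun j => 0 < f j y) A.
Proof.
elim: A => [|j B IHB] /=; first by move=> _; apply: nearW.
move=> /andP[fj /IHB]; have : \forall y \near x, 0 < f j y.
  exact: (f_cont (open_nbhs_nbhs (conj (open_gt (y := 0)) fj))).
by apply: filterS2 => y -> ->.
Qed.

End SignConditions.

Section Warren.
Variables (R : realType) (n : nat) (J : Type) (A : seq J).
Local Notation point := 'rV[R]_n.
Variable phi : J -> point -> R.
Hypothesis phi_cont : forall j, continuous (phi j).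

Lemma sign_class_min (H : point -> R) (rho : R) (x : point) :
    continuous H -> (forall y, rho <= `|y| -> 0 <= H y) ->
    (forall y, H y < 0 -> all (fun j => phi j y != 0) A) -> H x < 0 ->
  exists2 y, all (fun j => 0 < phi j x * phi j y) A &
    \forall z \near y, H y <= H z.
Proof.
move=> cH Hout Hnz Hx; pose f j y := phi j x * phi j y.
have cf j : continuous (f j).
  by move=> y; apply: continuousM; [apply: cst_continuous|apply: phi_cont].
pose Z := ([set y : point | (`|y| <= rho)%R] `&`
  [set y | all (fun j => 0 <= f j y) A])%classic.
have cZ : compact Z.
  apply: bounded_closed_compact.
    exists rho; split; first exact: num_real.
    by move=> s rs y [/= y_rho _]; apply: le_trans y_rho (ltW rs).
  apply: closedI; last exact: closed_all_ge0.
  apply: (@preimage_closed _ _ (fun y : point => `|y|) [set t | t <= rho]%classic).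
    by move=> y _; apply: norm_continuous.
  exact: closed_le.
have inside y : H y < 0 -> `|y| <= rho.
  by rewrite leNgt; apply: contraTN => /ltW/Hout; rewrite -leNgt.
have Zx : Z x.
  by split; [apply: inside|apply/allT => j; rewrite /f -expr2 sqr_ge0].
have [||y /set_mem[_ Zy] ymin] := @EVT_min_rV _ _ H Z _ cZ.
- by exists x.
- exact: continuous_subspaceT.
have Hy : H y < 0 by apply: le_lt_trans (ymin x (mem_set Zx)) Hx.
have fy : all (fun j => 0 < f j y) A.
  move: Zy (Hnz _ Hx) (Hnz _ Hy) => /=.
  elim: (A) => //= j B IHB /andP[fj /IHB{}IHB] /andP[xj /IHB{}IHB] /andP[yj /IHB->].
  by rewrite andbT lt_neqAle fj eq_sym mulf_neq0.
exists y => //; near=> z; have [Hz|] := ltP (H z) 0; last first.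
  by apply: le_trans; apply: ltW.
apply/ymin/mem_set; split; first exact: inside.
by apply: sub_all (near (near_all_gt0 cf fy) z _) => // j /ltW.
Unshelve. all: by end_near. Qed.

End Warren.

Lemma exists_pos_lt (F : realFieldType) (X : eqType) (N : seq X) (b : X -> F) :
  {in N, forall x, 0 < b x} ->
  exists2 eps, 0 < eps & {in N, forall x, eps < b x}.
Proof.
elim: N => [|x N IHN] bN; first by exists 1.
have [|eps eps0 epsN] := IHN; first by move=> y yN; apply: bN; rewrite inE yN orbT.
have bx : 0 < b x by apply: bN; rewrite mem_head.
have m0 : 0 < Num.min eps (b x) by rewrite lt_min eps0.
exists (Num.min eps (b x) / 2); first by rewrite divr_gt0.
have lt_m : Num.min eps (b x) / 2 < Num.min eps (b x).
  by rewrite ltr_pdivrMr // ltr_pMr // ltr1n.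
move=> y; rewrite inE => /predU1P[->|/epsN/ltW eps_y]; apply: lt_le_trans lt_m _;
  by rewrite ge_min ?lexx ?eps_y ?orbT.
Qed.

Section SignPatterns.
Variables (R : realType) (n k : nat) (J : eqType) (A : seq J).
Local Notation point := 'rV[R]_n.
Variable phi : J -> point -> R.
Hypothesis poly_phi : forall j, poly_fun k (phi j).

Local Notation sgn := (fun x j => 0 < phi j x).

Lemma eq_sign_pattern (x y : point) : all (fun j => 0 < phi j x * phi j y) A ->
  pattern sgn A y = pattern sgn A x.
Proof.
rewrite /pattern; elim: A => //= j B IHB /andP[jpos /IHB->]; congr (_ :: _).
move: jpos; have [x0|x0|<-] := ltgtP 0 (phi j x); last by rewrite mul0r ltxx.
  by rewrite pmulr_rgt0 // => ->.
by rewrite nmulr_rgt0 // => y0; apply/negbTE; rewrite -leNgt ltW.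
Qed.

Lemma sign_class_critical (G : point -> R) e (g : 'I_n -> point -> R) (eps : R)
    (x : point) :
    poly_fun e G -> ~~ odd e -> 0 < eps ->
    (forall y, 0 < G y -> all (fun j => phi j y != 0) A) ->
    (forall i y, is_derive y (delta_mx 0 i) G (g i y)) ->
    eps * \sum_i x 0 i ^+ e.+2 < G x ->
  exists2 y, all (fun j => 0 < phi j x * phi j y) A &
    forall i, y 0 i ^+ e.+1 = (eps * e.+2%:R)^-1 * g i y.
Proof.
move=> pG ev eps0 Gnz dG Gx.
pose H (y : point) := eps * (\sum_i y 0 i ^+ e.+2) - G y.
have dH i (y : point) :
    is_derive y (delta_mx 0 i) H (eps * (e.+2%:R * y 0 i ^+ e.+1) - g i y).
  exact: is_deriveB (is_deriveZ eps (is_derive_power_sum e.+2 y i)) (dG i y).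
have cH : continuous H.
  suff : poly_fun e.+2 H by apply: poly_fun_continuous.
  have pP : poly_fun e.+2 (fun y : point => \sum_i y 0 i ^+ e.+2).
    apply: poly_fun_sum => i; rewrite -[X in poly_fun X]muln1.
    exact/poly_funX/poly_fun_coord.
  have pG2 : poly_fun e.+2 G by apply: poly_funW pG; rewrite -addn2 leq_addr.
  by apply: eq_poly_fun (poly_funD (poly_funZ eps pP) (poly_funZ (-1) pG2)) => y;
    rewrite mulN1r.
have [rho Gsmall] := poly_fun_dominated pG ev eps0.
have pow_ge0 (y : point) : 0 <= eps * \sum_i y 0 i ^+ e.+2.
  apply: mulr_ge0; [exact: ltW | apply: sumr_ge0 => i _].
  by rewrite exprn_even_ge0 //= negbK.
have phi_cont j := poly_fun_continuous (poly_phi j).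
have [y|y||y xy ymin] := sign_class_min (A := A) (x := x) phi_cont cH (rho := rho).
- by rewrite subr_ge0; apply: Gsmall.
- by rewrite subr_lt0 => Hy; apply: Gnz; apply: le_lt_trans Hy.
- by rewrite subr_lt0.
exists y => // i; have Hder z : derivable H z (delta_mx 0 i) by have [] := dH i z.
have eD : eps * e.+2%:R != 0 by rewrite mulf_neq0 ?gt_eqF // ltr0n.
have [_ He] := dH i y; move: (derive_near_min Hder ymin).
by rewrite He => /eqP; rewrite subr_eq0 mulrA => /eqP <-; rewrite mulKf.
Qed.

(* Warren's bound.  With [G] the product of the squares, the function
   [eps * \sum_i x_i ^+ D - G] has a negative minimum in every sign class, and
   its critical points are counted by reduction modulo
   [x_i ^+ D.-1 = lower degree]. *)
Lemma sign_patterns_le (N : seq point) :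
    {in N, forall x, all (fun j => phi j x != 0) A} ->
    uniq [seq pattern sgn A x | x <- N] ->
  (size N <= (size A * (2 * k)).+1 ^ n)%N.
Proof.
move=> nz uN; set e := (size A * (2 * k))%N.
pose G (y : point) := \prod_(j <- A) phi j y ^+ 2.
have pG : poly_fun e G.
  rewrite /e -sum_nat_const_seq; apply: poly_fun_prod => j; exact: poly_funX.
have ev : ~~ odd e by rewrite /e oddM oddM andbF.
have G_ge0 y : 0 <= G y by apply: prodr_ge0 => j _; apply: sqr_ge0.
have G_gt0 y : (0 < G y) = all (fun j => phi j y != 0) A.
  rewrite lt_neqAle G_ge0 andbT eq_sym prodf_seq_neq0.
  by apply: eq_all => j /=; rewrite sqrf_eq0.
have sum_ge0 (x : point) : 0 <= \sum_i x 0 i ^+ e.+2.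
  by apply: sumr_ge0 => i _; rewrite exprn_even_ge0 //= negbK.
have [|eps eps0 epsN] :=
    @exists_pos_lt R _ N (fun x => G x / (\sum_i x 0 i ^+ e.+2 + 1)).
  by move=> x /nz; rewrite -G_gt0 => Gx; rewrite divr_gt0 // ltr_wpDl.
have {}epsN x : x \in N -> eps * \sum_i x 0 i ^+ e.+2 < G x.
  move=> /epsN; rewrite ltr_pdivlMr ?ltr_wpDl //; apply: le_lt_trans.
  by rewrite ler_pM2l // lerDl.
have [g gP] := choice (fun i => let: ex_intro2 g pg dg :=
  poly_fun_derive (delta_mx 0 i : point) pG in ex_intro _ g (conj pg dg)).
have critical x : exists y, x \in N ->
    all (fun j => 0 < phi j x * phi j y) A /\
    forall i, y 0 i ^+ e.+1 = (eps * e.+2%:R)^-1 * g i y.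
  have [xN|_] := boolP (x \in N); last by exists x.
  have Gnz y : 0 < G y -> all (fun j => phi j y != 0) A by rewrite G_gt0.
  have [y xy yE] := sign_class_critical pG ev eps0 Gnz (fun i => (gP i).2) (epsN x xN).
  by exists y.
have [Y YP] := choice critical.
have uY : uniq [seq Y x | x <- N].
  apply: (@map_uniq _ _ (pattern sgn A)); rewrite -map_comp.
  have /eq_in_map -> // : {in N, pattern sgn A \o Y =1 pattern sgn A}.
  by move=> x /YP[/eq_sign_pattern].
rewrite -(size_map Y).
apply: (power_system_roots_le (h := fun i y => (eps * e.+2%:R)^-1 * g i y)) => //.
  by move=> i; apply: poly_funZ; have [] := gP i.
by move=> i z /mapP[x /YP[_ xP] ->]; apply: xP.
Qed.

End SignPatterns.

(** * Covering points by few balls *)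

Lemma exp_dominates_poly (a n : nat) :
  exists2 d, (0 < d)%N & ((d * a).+1 ^ n < 2 ^ d)%N.
Proof.
have [->|n0] := posnP n; first by exists 1%N.
pose m := (n + a).+1; exists (2 ^ (3 * m))%N; first by rewrite expn_gt0.
have lt_m : (m < 2 ^ m)%N by apply: ltn_expl.
have exponent_lt : ((3 * m + a) * n < 2 ^ (3 * m))%N.
  apply: (@leq_trans (m.+1 ^ 3)); last by rewrite mulnC expnM leq_exp2r.
  by rewrite /m !expnS expn0; nia.
apply: leq_ltn_trans (_ : 2 ^ ((3 * m + a) * n) < _)%N; last by rewrite ltn_exp2l.
rewrite [leqRHS]expnM leq_exp2r // expnD; apply: (@leq_trans (2 ^ (3 * m) * a.+1)%N).
  by rewrite mulnS addnC -addn1 leq_add2l expn_gt0.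
by rewrite leq_mul2l ltn_expl ?orbT.
Qed.

Section Covers.
Variables (R : realType) (n k : nat).
Local Notation point := 'rV[R]_n.

Lemma sign_cover : exists C : nat, forall (J : eqType) (I : seq J)
    (phi : J -> point -> R) (N : seq point) (r : nat), (0 < r)%N ->
    (forall j, poly_fun k (phi j)) ->
    {in N, forall x, all (fun j => phi j x != 0) I} ->
  exists Z : seq point, [/\ {subset Z <= N}, (size Z <= C * r ^ n)%N &
    {in N, forall x, exists2 c, c \in Z &
      (r * separation I (fun x j => 0 < phi j x)%R x c <= size I)%N}].
Proof.
have [d d0 d_dominates] := exp_dominates_poly (2 * k) n.
pose q := (4 * d * (2 * k)).+1; exists (2 * q ^ n)%N => J I phi N r r0 pphi nz.
set sgn := fun x j => 0 < phi j x.
have [I0|I0] := posnP (size I).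
  case: N nz => [|x N] nz; first by exists [::]; split.
  exists [:: x]; split=> [y||y _].
  - by rewrite inE => /eqP->; rewrite mem_head.
  - by rewrite !muln_gt0 !expn_gt0 r0.
  - by exists x; rewrite ?mem_head // (size0nil I0) /separation muln0.
have [Z [uZ ZN sepZ cov]] := maximal_well_separated I sgn r N; exists Z; split=> //.
have nzZ (A : seq J) (M : seq point) : {subset A <= I} -> {subset M <= Z} ->
    {in M, forall x, all (fun j => phi j x != 0) A}.
  by move=> AI MZ x /MZ/ZN/nz/allP nzx; apply/allP => j /AI/nzx.
have s0 : (0 < 4 * d * r)%N by rewrite !muln_gt0 d0.
rewrite -mulnA -expnMn.
apply: (packing_bound I0 d0 uZ sepZ (prednK s0)) => [A AI|A sA AI].
  move=> /shatters_pred; case: d d0 d_dominates {q s0} => // d _ d_dominates.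
  move=> /shatters_reps[A' [N' [sA' A'A N'Z sN' uN']]].
  have := sign_patterns_le pphi (nzZ A' N' (fun j h => AI j (A'A j h)) N'Z) uN'.
  by rewrite sA' sN' leqNgt d_dominates.
have [N' [N'Z <- uN']] := class_count_reps sgn Z A.
apply: leq_trans (sign_patterns_le pphi (nzZ A N' AI N'Z) uN') _.
have le_base : ((size A * (2 * k)).+1 <= q * r)%N by rewrite sA /q; nia.
by case: n => // n'; rewrite leq_exp2r.
Qed.

Definition level_gap (V : seq R) (c v : R) : nat :=
  count (fun t => (t <= v) != (t <= c)) V.

Definition poly_levels (N : seq point) (g : point -> R) : Prop :=
  forall th, exists2 f : point -> R, poly_fun k f &
    {in N, forall x, Num.sg (f x) = Num.sg (g x - th)}.

Lemma exists_level_margin (B : eqType) (I : seq (B * R)) (g : B -> point -> R)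
    (N : seq point) :
  exists2 eps : R, 0 < eps &
    {in I & N, forall j x, g j.1 x < j.2 -> g j.1 x < j.2 - eps}.
Proof.
pose pairs := [seq (j, x) | j <- I, x <- N].
have [|eps eps0 epsP] := @exists_pos_lt R _
    [seq w <- pairs | g w.1.1 w.2 < w.1.2] (fun w => w.1.2 - g w.1.1 w.2).
  by move=> w; rewrite mem_filter subr_gt0 => /andP[].
exists eps => // j x jI xN gj.
have := epsP (j, x); rewrite mem_filter gj allpairs_f // => /(_ isT) /=.
by rewrite !ltrBrDl addrC.
Qed.

(* The thresholds are lowered by a small margin, so that no point of [N] lies on
   any of them. *)
Lemma level_cover : exists C : nat, forall (B : eqType) (bs : seq B)
    (V : B -> seq R) (g : B -> point -> R) (N : seq point) (r : nat), (0 < r)%N ->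
    {in bs, forall b, poly_levels N (g b)} ->
  exists Z : seq point, [/\ {subset Z <= N}, (size Z <= C * r ^ n)%N &
    {in N, forall x, exists2 c, c \in Z &
      (r * \sum_(b <- bs) level_gap (V b) (g b c) (g b x)
       <= \sum_(b <- bs) size (V b))%N}].
Proof.
have [C coverC] := sign_cover; exists C => B bs V g N r r0 pg.
pose I := [seq (b, v) | b <- bs, v <- V b].
have [eps eps0 epsP] := exists_level_margin I g N.
have thresholds (j : B * R) : exists f : point -> R, poly_fun k f /\
    (j.1 \in bs -> {in N, forall x, Num.sg (f x) = Num.sg (g j.1 x - (j.2 - eps))}).
  have [jbs|_] := boolP (j.1 \in bs); last first.
    by exists (fun=> 0); split=> //; apply: poly_fun_cst.
  by have [f pf fE] := pg j.1 jbs (j.2 - eps); exists f.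
have [phi phiP] := choice thresholds.
have sgnE j x : j \in I -> x \in N -> (0 < phi j x) = (j.2 <= g j.1 x) /\ phi j x != 0.
  move=> jI xN; have jbs : j.1 \in bs by move: jI => /allpairsPdep[b [v [bb _ ->]]].
  rewrite -sgr_gt0 -sgr_eq0 (phiP j).2 // sgr_gt0 sgr_eq0 subr_gt0 subr_eq0.
  have [gj|gj] := leP j.2 (g j.1 x).
    have lt_g : j.2 - eps < g j.1 x by apply: lt_le_trans gj; rewrite ltrBlDr ltrDl.
    by rewrite lt_g gt_eqF.
  by have lt_j := epsP j x jI xN gj; rewrite lt_gtF // lt_eqF.
have [|Z [ZN sZ cov]] := coverC _ I phi N r r0 (fun j => (phiP j).1).
  by move=> x xN; apply/allP => j jI; have [] := sgnE j x jI xN.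
exists Z; split=> // x xN; have [c cZ le_c] := cov x xN; exists c => //.
have <- : size I = (\sum_(b <- bs) size (V b))%N.
  by rewrite /I size_allpairs_dep sumnE big_map.
apply: leq_trans le_c; rewrite leq_mul2l; apply/orP; right; apply: eq_leq.
rewrite /separation (eq_in_count (a2 := fun j => (j.2 <= g j.1 x) != (j.2 <= g j.1 c))).
  rewrite /I count_flatten -map_comp sumnE big_map; apply: eq_bigr => b _ /=.
  by rewrite count_map.
by move=> j jI; have [-> _] := sgnE j x jI xN; have [-> _] := sgnE j c jI (ZN _ cZ).
Qed.

End Covers.

(** * Vectors *)

Local Notation "u '\x' v" := (cross_product u v) (at level 40).

Section Dot.
Variables (R : realType) (n : nat).
Local Notation point := 'rV[R]_n.
Implicit Types u v w : point.

Definition dot u v : R := \sum_i u 0 i * v 0 i.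

Lemma dotBr u v w : dot u (v - w) = dot u v - dot u w.
Proof. by rewrite /dot -sumrB; apply: eq_bigr => i _; rewrite !mxE mulrBr. Qed.

Lemma dot0v u : dot 0 u = 0.
Proof. by rewrite /dot big1 // => i _; rewrite mxE mul0r. Qed.

Lemma dot_scale (a : R) u : dot (a *: u) (a *: u) = a ^+ 2 * dot u u.
Proof.
by rewrite /dot big_distrr; apply: eq_bigr => i _; rewrite !mxE mulrACA expr2.
Qed.

Lemma dot_ge0 u : 0 <= dot u u.
Proof. by apply: sumr_ge0 => i _; rewrite -expr2 sqr_ge0. Qed.

Lemma dot_eq0 u : (dot u u == 0) = (u == 0).
Proof.
apply/eqP/eqP => [/eqP|->]; last by rewrite dot0v.
rewrite psumr_eq0 => [/allP u0|i _]; last by rewrite -expr2 sqr_ge0.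
apply/rowP => i; rewrite mxE; apply/eqP.
by have := u0 i (mem_index_enum i); rewrite mulf_eq0 orbb.
Qed.

Lemma poly_fun_dot u : poly_fun 1 (dot u).
Proof. by apply: poly_fun_sum => i; apply/poly_funZ/poly_fun_coord. Qed.

Lemma poly_nonroot (p : {poly R}) : p != 0 -> exists t, p.[t] != 0.
Proof.
move=> p0; pose ts : seq R := [seq i%:R | i <- iota 0 (size p)].
have [/hasP[t _ pt]|/hasPn all0] := boolP (has (fun t => p.[t] != 0) ts).
  by exists t.
have uts : uniq ts.
  by rewrite map_inj_uniq ?iota_uniq // => i j /eqP; rewrite eqr_nat => /eqP.
have : all (root p) ts by apply/allP => t /all0; rewrite negbK.
by move=> /(max_poly_roots p0)/(_ uts); rewrite size_map size_iota ltnn.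
Qed.

(* A point of the moment curve outside finitely many hyperplanes. *)
Lemma exists_nonorthogonal (us : seq point) : 0 \notin us ->
  exists e : point, {in us, forall u, dot e u != 0}.
Proof.
move=> us0; pose moment (t : R) : point := \row_i t ^+ i.
have dot_moment t u : dot (moment t) u = (rVpoly u).[t].
  rewrite horner_poly; apply: eq_bigr => i _.
  by rewrite mxE mulrC; case: insubP => [j _ /val_inj->|/negP[]].
have /poly_nonroot[t] : \prod_(u <- us) rVpoly u != 0.
  rewrite prodf_seq_neq0; apply/allP => u uus /=; apply: contraNneq us0 => u0.
  by rewrite -(rVpolyK u) u0 raddf0 in uus.
rewrite horner_prod prodf_seq_neq0 => /allP nz.
by exists (moment t) => u /nz; rewrite dot_moment.
Qed.

End Dot.

Section CrossProduct.
Variable R : realType.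
Local Notation point := 'rV[R]_3.
Implicit Types (u v w p q r : point).

Lemma sum3E (F : 'I_3 -> R) : \sum_i F i = F 0 + F 1 + F 2%:R.
Proof.
rewrite !big_ord_recl big_ord0 addr0 addrA; congr (F _ + F _ + F _);
  exact/val_inj.
Qed.

Lemma dotE u v : dot u v = u 0 0 * v 0 0 + u 0 1 * v 0 1 + u 0 2%:R * v 0 2%:R.
Proof. exact: sum3E. Qed.

Lemma cross0E u v : (u \x v) 0 0 = u 0 1 * v 0 2%:R - u 0 2%:R * v 0 1.
Proof. by rewrite mxE !add0r. Qed.

Lemma cross1E u v : (u \x v) 0 1 = u 0 2%:R * v 0 0 - u 0 0 * v 0 2%:R.
Proof.
rewrite mxE; have -> : (1 + 1 : 'I_3) = 2%:R by [].
by have -> : (1 + 2%:R : 'I_3) = 0 by apply/val_inj.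
Qed.

Lemma cross2E u v : (u \x v) 0 2%:R = u 0 0 * v 0 1 - u 0 1 * v 0 0.
Proof.
rewrite mxE; have -> : (2%:R + 1 : 'I_3) = 0 by apply/val_inj.
by have -> : (2%:R + 2%:R : 'I_3) = 1 by apply/val_inj.
Qed.

Lemma coord0 i : (0 : point) 0 i = 0. Proof. exact: mxE. Qed.
Lemma coordD u v i : (u + v) 0 i = u 0 i + v 0 i. Proof. exact: mxE. Qed.
Lemma coordN u i : (- u) 0 i = - u 0 i. Proof. exact: mxE. Qed.
Lemma coordZ k u i : (k *: u) 0 i = k * u 0 i. Proof. exact: mxE. Qed.

Definition coordE := (coord0, coordD, coordN, coordZ, (cross0E, cross1E, cross2E)).

Lemma eq_row3 u v : [/\ u 0 0 = v 0 0, u 0 1 = v 0 1 & u 0 2%:R = v 0 2%:R] -> u = v.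
Proof.
move=> [e0 e1 e2]; apply/rowP => -[[|[|[|//]]] i3].
- by rewrite (_ : Ordinal i3 = 0) //; apply/val_inj.
- by rewrite (_ : Ordinal i3 = 1) //; apply/val_inj.
- by rewrite (_ : Ordinal i3 = 2%:R) //; apply/val_inj.
Qed.

Lemma crossvv u : u \x u = 0.
Proof. by apply: eq_row3; rewrite !coordE; split; ring. Qed.

Lemma cross0v u : 0 \x u = 0.
Proof. by apply: eq_row3; rewrite !coordE; split; ring. Qed.

Lemma crossv0 u : u \x 0 = 0.
Proof. by apply: eq_row3; rewrite !coordE; split; ring. Qed.

Lemma crossC u v : v \x u = - (u \x v).
Proof. by apply: eq_row3; rewrite !coordE; split; ring. Qed.

Lemma crossZ (a b : R) u v : (a *: u) \x (b *: v) = (a * b) *: (u \x v).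
Proof. by apply: eq_row3; rewrite !coordE; split; ring. Qed.

Lemma dot_cross_cross u v :
  dot (u \x v) (u \x v) = dot u u * dot v v - dot u v ^+ 2.
Proof. by rewrite !dotE !coordE; ring. Qed.

Lemma cross_crossr u v : u \x (u \x v) = dot u v *: u - dot u u *: v.
Proof. by apply: eq_row3; rewrite !dotE !coordE; split; ring. Qed.

Lemma cross_eq0P u v : u != 0 -> reflect (exists k, v = k *: u) (u \x v == 0).
Proof.
move=> u0; apply: (iffP eqP) => [uv|[k ->]]; last first.
  by rewrite -[X in X \x _]scale1r crossZ crossvv scaler0.
have d0 : dot u u != 0 by rewrite dot_eq0.
exists (dot u v / dot u u); apply: (scalerI d0).
rewrite scalerA mulrCA divff // mulr1; apply/esym/eqP; rewrite -subr_eq0.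
by rewrite -cross_crossr uv crossv0.
Qed.

Lemma cross_trans0 u p q : u != 0 -> u \x p = 0 -> u \x q = 0 -> p \x q = 0.
Proof.
move=> u0 /eqP/(cross_eq0P _ u0)[k ->] /eqP/(cross_eq0P _ u0)[l ->].
by rewrite crossZ crossvv scaler0.
Qed.

Definition det3 p q r : R := dot (p \x q) r.

Lemma cramer3 p q r u :
  det3 p q r *: u = dot p u *: (q \x r) + dot q u *: (r \x p) + dot r u *: (p \x q).
Proof. by apply: eq_row3; rewrite /det3 !dotE !coordE; split; ring. Qed.

(* The squared length of [b] times the squared distance of [p] from the line
   through the origin in direction [b]. *)
Definition axis_value (b p : point) : R := dot (b \x p) (b \x p).

Lemma axis_value_eq0 b p : (axis_value b p == 0) = (b \x p == 0).
Proof. exact: dot_eq0. Qed.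

Lemma axis_valueZr (t : R) b p : axis_value b (t *: p) = t ^+ 2 * axis_value b p.
Proof. by rewrite /axis_value -{1 2}[b]scale1r crossZ mul1r dot_scale. Qed.

Lemma poly_fun_axis_value b : poly_fun 2 (axis_value b).
Proof.
apply: poly_fun_sum => i; apply: (@poly_funM _ _ 1 1);
  apply: (eq_poly_fun (f := fun p : point => b 0 (i + 1) * p 0 (i + 2%:R)
    + - b 0 (i + 2%:R) * p 0 (i + 1))) => [p|]; rewrite ?mxE ?mulNr //;
  by apply: poly_funD; apply/poly_funZ/poly_fun_coord.
Qed.

Lemma axis_value_poly_levels (N : seq point) b : poly_levels 2 N (axis_value b).
Proof.
move=> th; exists (fun p => axis_value b p + - th) => // ; apply: poly_funD.
  exact: poly_fun_axis_value.
exact: poly_fun_cst.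
Qed.

End CrossProduct.

(** * Points on a common cylinder around many axes *)

Section PolySize.
Variable F : nzRingType.
Implicit Types f g : {poly F}.

Lemma size_polyM_leS f g d e :
  (size f <= d.+1)%N -> (size g <= e.+1)%N -> (size (f * g)%R <= (d + e).+1)%N.
Proof. by move=> sf sg; apply: leq_trans (size_polyMleq _ _) _; lia. Qed.

Lemma size_polyD_le f g d :
  (size f <= d)%N -> (size g <= d)%N -> (size (f + g)%R <= d)%N.
Proof. by move=> sf sg; apply: leq_trans (size_polyD _ _) _; rewrite geq_max sf. Qed.

Lemma size_polyZ_le a f d : (size f <= d)%N -> (size (a *: f)%R <= d)%N.
Proof. exact: leq_trans (size_scale_leq _ _). Qed.

Lemma size_polyC_subX a : (size (a%:P - 'X : {poly F})%R <= 2)%N.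
Proof. by rewrite -opprB size_polyN size_XsubC. Qed.

End PolySize.

Section ThreePoints.
Variable R : realType.
Local Notation point := 'rV[R]_3.
Variables p q r : point.

Definition dual_combination (a b c : R) : point :=
  a *: (q \x r) + b *: (r \x p) + c *: (p \x q).

Definition gram_defect (a b c : R) : R :=
  det3 p q r ^+ 2 - dot (dual_combination a b c) (dual_combination a b c).

(* If [u] is a unit vector and [p, q, r] have the same squared distance [w] from
   the axis [u], then [dot p u ^+ 2 = dot p p - w] and likewise for [q] and [r],
   and the Gram defect vanishes at the three scalar products.  The polynomial
   below is the product of the Gram defects over all choices of their signs. *)
Definition axis_eliminant : {poly R} :=
  let c1 := q \x r in let c2 := r \x p in let c3 := p \x q in
  let A := (dot p p)%:P - 'X in
  let B := (dot q q)%:P - 'X in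
  let C := (dot r r)%:P - 'X in
  let s := (det3 p q r ^+ 2)%:P
    - (dot c1 c1 *: A + dot c2 c2 *: B + dot c3 c3 *: C) in
  let X2 := (4 * dot c1 c2 ^+ 2) *: (A * B) in
  let Y2 := (4 * dot c1 c3 ^+ 2) *: (A * C) in
  let Z2 := (4 * dot c2 c3 ^+ 2) *: (B * C) in
  s * s * (s * s) + X2 * X2 + Y2 * Y2 + Z2 * Z2
  + (- 2) *: (s * s * (X2 + Y2 + Z2) + X2 * Y2 + X2 * Z2 + Y2 * Z2)
  + (- 64 * (dot c1 c2 * dot c1 c3 * dot c2 c3)) *: (s * A * (B * C)).

Lemma size_axis_eliminant : (size axis_eliminant <= 5)%N.
Proof.
rewrite /axis_eliminant.
set A := _ - 'X; set B := _ - 'X; set C := _ - 'X; set s := _ - _.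
have [sA sB sC] : [/\ size A <= 2, size B <= 2 & size C <= 2]%N.
  by split; apply: size_polyC_subX.
have ss : (size s <= 2)%N.
  apply: size_polyD_le; first exact: leq_trans (size_polyC_leq1 _) _.
  by rewrite size_polyN; do !apply: size_polyD_le; apply: size_polyZ_le.
have size3 (f g : {poly R}) :
    (size f <= 2)%N -> (size g <= 2)%N -> (size (f * g)%R <= 3)%N.
  exact: (@size_polyM_leS _ f g 1 1).
have size5 (f g : {poly R}) :
    (size f <= 3)%N -> (size g <= 3)%N -> (size (f * g)%R <= 5)%N.
  exact: (@size_polyM_leS _ f g 2 2).
set X2 := _ *: (A * B); set Y2 := _ *: (A * C); set Z2 := _ *: (B * C).
have sX : (size X2 <= 3)%N by apply/size_polyZ_le/size3.
have sY : (size Y2 <= 3)%N by apply/size_polyZ_le/size3.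
have sZ : (size Z2 <= 3)%N by apply/size_polyZ_le/size3.
have s2 := size3 s s ss ss; have sXY := size_polyD_le sX sY.
apply: size_polyD_le; last by apply/size_polyZ_le/size5; apply: size3.
apply: size_polyD_le; first by do !apply: size_polyD_le; apply: size5.
apply: size_polyZ_le; do !apply: size_polyD_le; apply: size5 => //.
exact: size_polyD_le.
Qed.

Lemma horner_axis_eliminant (w x y z : R) :
    dot p p - w = x ^+ 2 -> dot q q - w = y ^+ 2 -> dot r r - w = z ^+ 2 ->
  axis_eliminant.[w] = gram_defect x y z * gram_defect x y (- z)
    * gram_defect x (- y) z * gram_defect (- x) y z.
Proof.
move=> ep eq er.
have defectE a b c : gram_defect a b c = det3 p q r ^+ 2
    - (dot (q \x r) (q \x r) * a ^+ 2 + dot (r \x p) (r \x p) * b ^+ 2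
       + dot (p \x q) (p \x q) * c ^+ 2)
    - 2 * dot (q \x r) (r \x p) * (a * b) - 2 * dot (q \x r) (p \x q) * (a * c)
    - 2 * dot (r \x p) (p \x q) * (b * c).
  rewrite /gram_defect /dual_combination; move: (q \x r) (r \x p) (p \x q) => c1 c2 c3.
  by rewrite !dotE !coordE; ring.
rewrite /axis_eliminant !defectE; move: (q \x r) (r \x p) (p \x q) => c1 c2 c3.
by rewrite !(hornerD, hornerN, hornerZ, hornerM, hornerC, hornerX) ep eq er; ring.
Qed.

Lemma root_axis_eliminant u (w : R) : dot u u = 1 ->
    dot p p - w = dot p u ^+ 2 -> dot q q - w = dot q u ^+ 2 ->
    dot r r - w = dot r u ^+ 2 ->
  root axis_eliminant w.
Proof.
move=> u1 ep eq er; rewrite /root (horner_axis_eliminant ep eq er).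
have -> : gram_defect (dot p u) (dot q u) (dot r u) = 0.
  by rewrite /gram_defect /dual_combination -cramer3 dot_scale u1 mulr1 subrr.
by rewrite !mul0r.
Qed.

Hypotheses (pq : p \x q != 0) (qr : q \x r != 0) (rp : r \x p != 0).

Lemma gram_defect_neq0 (a b c : R) :
    a ^+ 2 = dot p p -> b ^+ 2 = dot q q -> c ^+ 2 = dot r r ->
  gram_defect a b c != 0.
Proof.
move=> ap bq cr; rewrite subr_eq0 eq_sym; apply/eqP.
set U := dual_combination a b c => UU.
have [Up Uq] : dot U p = a * det3 p q r /\ dot U q = b * det3 p q r.
  by rewrite /U /dual_combination /det3 !dotE !coordE; split; ring.
have [d0|d0] := eqVneq (det3 p q r) 0; last first.
  have U0 : U != 0 by rewrite -dot_eq0 UU expf_neq0.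
  case/eqP: pq; apply: (cross_trans0 U0); apply/eqP;
    rewrite -dot_eq0 dot_cross_cross UU.
    by rewrite Up -ap; apply/eqP; ring.
  by rewrite Uq -bq; apply/eqP; ring.
have U0 : U = 0 by apply/eqP; rewrite -dot_eq0 UU d0 expr0n.
have angle_neq0 u v (s t : R) : s ^+ 2 = dot u u -> t ^+ 2 = dot v v ->
    u \x v != 0 -> dot u v - s * t != 0.
  move=> su tv; apply: contraNneq => /eqP; rewrite subr_eq0 => /eqP uv.
  by rewrite -dot_eq0 dot_cross_cross uv -su -tv; apply/eqP; ring.
have x0 := angle_neq0 p q a b ap bq pq.
have y0 := angle_neq0 r p c a cr ap rp.
have z0 := angle_neq0 q r b c bq cr qr.
set x := _ - _ in x0; set y := _ - _ in y0; set z := _ - _ in z0.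
have /eqP : x * (a * z + b * y - c * x) = 0.
  transitivity (dot U (p \x q)); last by rewrite U0 dot0v.
  have -> : dot U (p \x q) = a * (dot p q * dot q r - dot q q * dot r p)
      + b * (dot r p * dot p q - dot p p * dot q r)
      + c * (dot p p * dot q q - dot p q ^+ 2).
    by rewrite /U /dual_combination !dotE !coordE; ring.
  by rewrite -ap -bq /x /y /z; ring.
have /eqP : y * (a * z + c * x - b * y) = 0.
  transitivity (dot U (r \x p)); last by rewrite U0 dot0v.
  have -> : dot U (r \x p) = a * (dot q r * dot r p - dot r r * dot p q)
      + b * (dot r r * dot p p - dot r p ^+ 2)
      + c * (dot p q * dot r p - dot p p * dot q r).
    by rewrite /U /dual_combination !dotE !coordE; ring.
  by rewrite -ap -cr /x /y /z; ring.
rewrite !mulf_eq0 (negbTE x0) (negbTE y0) /= => /eqP eq_y /eqP eq_x.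
have /eqP : a * z = 0 by lra.
rewrite mulf_eq0 (negbTE z0) orbF => /eqP a0; case/eqP: pq.
have /eqP -> : p == 0 by rewrite -dot_eq0 -ap a0 expr0n.
exact: cross0v.
Qed.

Lemma axis_eliminant_neq0 : axis_eliminant != 0.
Proof.
apply/negP => /eqP Phi0; have sq (u : point) : Num.sqrt (dot u u) ^+ 2 = dot u u.
  by rewrite sqr_sqrtr // dot_ge0.
have sqN (u : point) : (- Num.sqrt (dot u u)) ^+ 2 = dot u u by rewrite sqrrN.
have := @horner_axis_eliminant 0 _ _ _ (etrans (subr0 _) (esym (sq p)))
  (etrans (subr0 _) (esym (sq q))) (etrans (subr0 _) (esym (sq r))).
rewrite Phi0 horner0 => /esym/eqP; apply/negP.
by rewrite !mulf_neq0 // gram_defect_neq0.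
Qed.

Lemma sqr_dot_normal u : dot u u = 1 ->
  dot (p \x q) u ^+ 2 = dot p p * dot q q - dot p q ^+ 2
    + 2 * dot p q * dot p u * dot q u - dot p p * dot q u ^+ 2
    - dot q q * dot p u ^+ 2.
Proof.
move=> u1; have -> : dot p p * dot q q - dot p q ^+ 2 =
    (dot p p * dot q q - dot p q ^+ 2) * dot u u by rewrite u1 mulr1.
by rewrite !dotE !coordE; ring.
Qed.

(* At most four radii, and each radius determines the axis up to three signs. *)
Lemma unit_axes_le (us : seq point) : uniq us ->
    {in us, forall u, [/\ dot u u = 1,
       dot q q - dot q u ^+ 2 = dot p p - dot p u ^+ 2 &
       dot r r - dot r u ^+ 2 = dot p p - dot p u ^+ 2]} ->
  (size us <= 32)%N.
Proof.
move=> uus axes; pose w u := dot p p - dot p u ^+ 2; pose n := p \x q.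
have eq_sqr_sign (s t : R) : s ^+ 2 = t ^+ 2 -> (0 <= s) = (0 <= t) -> s = t.
  move=> /eqP; rewrite eqf_sqr => /orP[/eqP//|/eqP->].
  by have [t0|t0] := leP 0 t; have [s0|s0] := leP 0 (- t) => //; lra.
pose code u := (w u, (0 <= dot p u, (0 <= dot q u, 0 <= dot n u))).
have code_inj : {in us &, injective code}.
  move=> u v uin vin [wuv sp sq sn].
  have [[u1 qu _] [v1 qv _]] := (axes u uin, axes v vin).
  have pE : dot p u = dot p v by apply: eq_sqr_sign => //; move: wuv; rewrite /w; lra.
  have qE : dot q u = dot q v by apply: eq_sqr_sign => //; move: qu qv; rewrite pE; lra.
  have nE : dot n u = dot n v.
    by apply: eq_sqr_sign => //; rewrite !sqr_dot_normal // pE qE.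
  have det_n : det3 p q n != 0 by rewrite /det3 dot_eq0.
  by apply: (scalerI det_n); rewrite (cramer3 p q n u) (cramer3 p q n v) pE qE nE.
pose ws := undup [seq w u | u <- us].
have size_ws : (size ws <= 4)%N.
  rewrite -ltnS; apply: leq_trans size_axis_eliminant.
  apply: max_poly_roots (undup_uniq _); first exact: axis_eliminant_neq0.
  apply/allP => t; rewrite mem_undup => /mapP[u /axes[u1 qu ru] ->].
  apply: (root_axis_eliminant u1); first by rewrite /w; lra.
    by rewrite /w -qu; lra.
  by rewrite /w -ru; lra.
pose signs := [:: true; false].
pose codes := allpairs pair ws (allpairs pair signs (allpairs pair signs signs)).
have : (size codes <= 32)%N.
  by rewrite !size_allpairs; apply: (leq_mul size_ws (leqnn 8)).
apply: leq_trans; rewrite -(size_map code); apply: uniq_leq_size.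
  by rewrite map_inj_in_uniq.
move=> _ /mapP[u uin ->]; apply: allpairs_f; first by rewrite mem_undup map_f.
by do !apply: allpairs_f; rewrite !inE; case: (0 <= _).
Qed.

Lemma common_cylinders_le (bs : seq point) : uniq bs -> 0 \notin bs ->
    {in bs &, forall b c, b != c -> b \x c != 0} ->
    {in bs, forall b, axis_value b q = axis_value b p /\
                      axis_value b r = axis_value b p} ->
  (size bs <= 32)%N.
Proof.
move=> ubs bs0 indep levels.
pose norm (b : point) : R := Num.sqrt (dot b b); pose unit b := (norm b)^-1 *: b.
have norm2 b : norm b ^+ 2 = dot b b by rewrite sqr_sqrtr // dot_ge0.
have norm0 b : b \in bs -> norm b != 0.
  by move=> bin; rewrite -sqrf_eq0 norm2 dot_eq0; apply: contraNneq bs0 => <-.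
have unit1 b : b \in bs -> dot (unit b) (unit b) = 1.
  by move=> bin; rewrite dot_scale exprVn norm2 mulVf // -norm2 sqrf_eq0 norm0.
have levelE b t : b \in bs ->
    dot t t - dot t (unit b) ^+ 2 = (norm b ^+ 2)^-1 * axis_value b t.
  move=> bin; have -> : dot t (unit b) = (norm b)^-1 * dot b t.
    by rewrite /unit !dotE !coordE; ring.
  rewrite /axis_value dot_cross_cross exprMn exprVn -(norm2 b) mulrBr mulKf //.
  by rewrite sqrf_eq0 norm0.
rewrite -(size_map unit); apply: unit_axes_le.
  rewrite map_inj_in_uniq // => b c bin cin bc; apply/eqP; apply: contraT => b_c.
  have := indep b c bin cin b_c.
  rewrite -[b](scalerKV (norm0 b bin)) -[c](scalerKV (norm0 c cin)).
  by rewrite -!/(unit _) crossZ bc crossvv scaler0 eqxx.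
move=> _ /mapP[b bin ->]; have [bq br] := levels b bin.
by rewrite unit1 // !levelE // bq br.
Qed.

End ThreePoints.

(** * Double counting of triples *)

Local Open Scope nat_scope.

Lemma distinct_triples_ge (T : eqType) (s : seq T) : uniq s ->
  size s * (size s).-1 * (size s).-2 <=
  \sum_(x <- s) \sum_(y <- s) \sum_(z <- s) [&& x != y, y != z & x != z].
Proof.
move=> us; rewrite -mulnA -sum_nat_const_seq; apply: leq_sum_in => x xs.
rewrite -(count_predC1 us xs) [X in X * _]countE big_distrl.
apply: leq_sum_in => y ys /=.
have [->|xy] := eqVneq y x; first by rewrite mul0n.
have ys' : y \in [seq z <- s | predC1 x z] by rewrite mem_filter /= xy.
rewrite mul1n -countE -size_filter -(count_predC1 (filter_uniq _ us) ys').
rewrite count_filter; apply: eq_leq; apply: eq_count => z.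
by rewrite /= ![z == _]eq_sym.
Qed.

Lemma sum_value_triples_le (T U : eqType) (f : T -> U) (s : seq T) : uniq s ->
  \sum_(v <- values f s) count (fun x => f x == v) s
    * (count (fun x => f x == v) s).-1 * (count (fun x => f x == v) s).-2 <=
  \sum_(x <- s) \sum_(y <- s) \sum_(z <- s)
    [&& x != y, y != z, x != z, f y == f x & f z == f x].
Proof.
move=> us; rewrite (big_values f); apply: leq_sum => v _; rewrite -size_filter.
apply: leq_trans (distinct_triples_ge (filter_uniq _ us)) _.
rewrite big_filter; apply: leq_sum => x /eqP fx.
rewrite big_filter big_mkcond; apply: leq_sum => y _.
case: eqP => // fy; rewrite big_filter big_mkcond; apply: leq_sum => z _.
by case: eqP => // fz; rewrite fx fy fz !eqxx !andbT.
Qed.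

Section Incidences.
Variables (T U V : eqType) (f : T -> U -> V) (bs : seq T) (G : seq U).
Variables (good : T -> pred U) (K H : nat).
Hypothesis uG : uniq G.
Hypothesis few_common : {in G & &, forall x y z, x != y -> y != z -> x != z ->
  count (fun b => (f b y == f b x) && (f b z == f b x)) bs <= K}.
Hypothesis few_values : {in bs, forall b,
  size (values (f b) [seq x <- G | good b x]) <= H}.

Local Notation value_count b v := (count (fun x => f b x == v) [seq x <- G | good b x]).

Lemma sum_triples_le :
  \sum_(b <- bs) \sum_(v <- values (f b) [seq x <- G | good b x])
    value_count b v * (value_count b v).-1 * (value_count b v).-2
  <= K * size G ^ 3.
Proof.
pose same b x y z := [&& x != y, y != z, x != z, f b y == f b x & f b z == f b x].
apply: (@leq_trans (\sum_(b <- bs) \sum_(x <- G) \sum_(y <- G) \sum_(z <- G)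
    same b x y z)).
  apply: leq_sum => b _.
  apply: leq_trans (sum_value_triples_le _ (filter_uniq _ uG)) _.
  rewrite big_filter big_mkcond; apply: leq_sum => x _; case: ifP => // _.
  rewrite big_filter big_mkcond; apply: leq_sum => y _; case: ifP => // _.
  by rewrite big_filter big_mkcond; apply: leq_sum => z _; case: ifP.
have -> : K * size G ^ 3 = \sum_(x <- G) \sum_(y <- G) \sum_(z <- G) K.
  by rewrite !sum_nat_const_seq !expnS expn0 muln1 mulnC !mulnA.
rewrite exchange_big; apply: leq_sum_in => x xG.
rewrite exchange_big; apply: leq_sum_in => y yG.
rewrite exchange_big; apply: leq_sum_in => z zG; rewrite /same -countE.
have [_|xy] := eqVneq x y; first by rewrite count_pred0.
have [_|yz] := eqVneq y z; first by rewrite count_pred0.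
have [_|xz] := eqVneq x z; first by rewrite count_pred0.
exact: few_common.
Qed.

Lemma incidences_le k : 4 <= k ->
  k ^ 2 * \sum_(b <- bs) count (good b) G <=
  4 * K * size G ^ 3 + k ^ 3 * (size bs * H).
Proof.
move=> k4.
have cubes c : k ^ 2 * c <= 4 * (c * c.-1 * c.-2) + k ^ 3.
  have [ck|kc] := leqP c k; first by rewrite [k ^ 3]expnSr; nia.
  have c3 : c ^ 2 <= 4 * (c.-1 * c.-2) by case: c kc => [|[|c]] //=; nia.
  have : k ^ 2 <= c ^ 2 by rewrite leq_exp2r // ltnW.
  by move: c3; move: (k ^ 2) (c ^ 2) (c.-1) (c.-2) (k ^ 3) => a b x y z; nia.
apply: (@leq_trans (\sum_(b <- bs) \sum_(v <- values (f b) [seq x <- G | good b x])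
    (4 * (value_count b v * (value_count b v).-1 * (value_count b v).-2) + k ^ 3))).
  rewrite big_distrr; apply: leq_sum => b _ /=.
  rewrite -size_filter -(sum_count_values (f b)) big_distrr.
  by apply: leq_sum => v _; apply: cubes.
under eq_bigr => b _ do rewrite big_split -big_distrr /= sum_nat_const_seq.
rewrite big_split -big_distrr -big_distrl /= -mulnA [k ^ 3 * _]mulnC.
apply: leq_add; first by rewrite leq_mul2l sum_triples_le.
by rewrite leq_mul2r -sum_nat_const_seq leq_sum_in ?orbT.
Qed.

Lemma rich_points_lt : 0 < H ->
    {in G, forall x, size bs <= 2 * count (good^~ x) bs} ->
    1024 * K * H ^ 2 < size bs ->
  size G < 16 * H.
Proof.
move=> H0 rich bs_gt; rewrite ltnNge; apply/negP => G_ge.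
have incidences_ge : size G * size bs <= 2 * \sum_(b <- bs) count (good b) G.
  by rewrite double_count big_distrr -sum_nat_const_seq leq_sum_in.
pose k := size G %/ (4 * H).
have k4 : 4 <= k by rewrite leq_divRL ?muln_gt0 // mulnA.
have kH_le : k * (4 * H) <= size G by apply: leq_divM.
have le_kH : size G <= 8 * H * k.
  have : size G < k.+1 * (4 * H) by rewrite -ltn_divLR // muln_gt0.
  by nia.
have [g0 k0] : 0 < size G /\ 0 < k ^ 2 by rewrite expn_gt0; split; lia.
have upper : k ^ 2 * (size G * size bs) <=
    8 * K * size G ^ 3 + 2 * (k ^ 3 * (size bs * H)).
  have := incidences_le k4; move: incidences_ge.
  by move: (\sum_(b <- bs) _) (k ^ 2) (size G ^ 3) (k ^ 3 * _) => I a c d; nia.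
have half : 4 * (k ^ 3 * (size bs * H)) <= k ^ 2 * (size G * size bs).
  rewrite expnSr; have -> : 4 * (k ^ 2 * k * (size bs * H)) =
    k ^ 2 * (k * (4 * H) * size bs) by lia.
  by rewrite leq_mul2l leq_mul2r kH_le !orbT.
have small : k ^ 2 * size bs <= 16 * K * size G ^ 2.
  rewrite -(leq_pmul2r g0) -[leqRHS]mulnA -expnSr.
  by rewrite -mulnA [size bs * _]mulnC; lia.
have : k ^ 2 * size bs <= k ^ 2 * (1024 * K * H ^ 2).
  apply: leq_trans small _.
  apply: (@leq_trans (16 * K * (8 * H * k) ^ 2)).
    by rewrite leq_mul2l leq_exp2r ?le_kH ?orbT.
  by rewrite !expnMn; lia.
by rewrite leq_pmul2l // leqNgt bs_gt.
Qed.

End Incidences.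

(** * Levels close to a given one *)

Local Open Scope ring_scope.

Lemma window_weight (R : realType) (V V' W : seq R) (c : R) (h k : nat) : uniq W ->
    (forall P : pred R, (count P V' <= count P V)%N) ->
    {in W, forall v, (count_mem v V' <= k)%N} ->
    {in W, forall v, (level_gap V c v <= h)%N} ->
  (\sum_(v <- W) count_mem v V' <= h.*2 + k)%N.
Proof.
move=> uW V'V lek gap.
have weightE (s : seq R) :
    uniq s -> (\sum_(v <- s) count_mem v V' = count (mem s) V')%N.
  move=> us; rewrite double_count countE; apply: eq_bigr => t _.
  by rewrite /= -(count_eq_uniq _ us).
have le_gap (s : seq R) m : m \in W ->
    {in s, forall t, (t <= m) != (t <= c)} -> (count (mem s) V' <= h)%N.
  move=> /gap m_gap s_gap; apply: leq_trans (V'V _) (leq_trans _ m_gap).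
  by apply: sub_count => t /= /s_gap.
pose above := [seq v <- W | c < v]; pose below := [seq v <- W | v <= c].
have -> : (\sum_(v <- W) count_mem v V' =
    \sum_(v <- above) count_mem v V' + \sum_(v <- below) count_mem v V')%N.
  rewrite !big_filter (bigID (fun v => c < v)); congr (_ + _)%N.
  by apply: eq_bigl => v; rewrite -leNgt.
rewrite -addnn -addnA; apply: leq_add.
  rewrite weightE ?filter_uniq //; have [->|above0] := eqVneq above [::].
    by rewrite count_pred0.
  have [m mW mle] := seq_argmax id above0.
  apply: (le_gap _ m); first by move: mW; rewrite mem_filter => /andP[].
  by move=> t tW; rewrite mle // leNgt; move: tW; rewrite mem_filter => /andP[->].
have [->|below0] := eqVneq below [::]; first by rewrite big_nil.
have [m mW mle] := seq_argmax -%R below0.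
have [mc m_in] : m <= c /\ m \in W by move: mW; rewrite mem_filter => /andP[].
have ubelow : uniq below by apply: filter_uniq.
rewrite (big_rem m) //= addnC; apply: leq_add; last exact: lek.
rewrite weightE ?rem_uniq //; apply: (le_gap _ m) => // t.
rewrite mem_rem_uniq // inE => /andP[tm tW].
have := mle t tW; rewrite lerN2 le_eqVlt eq_sym (negbTE tm) /= => /lt_geF->.
by move: tW; rewrite mem_filter => /andP[->].
Qed.

Local Open Scope nat_scope.

Lemma window_size (R : realType) (V W : seq R) (c : R) (h : nat) : uniq W ->
    {subset W <= V} -> {in W, forall v, level_gap V c v <= h} ->
  size W <= h.*2.+1.
Proof.
move=> uW WV gap; rewrite -addn1 -[size W]muln1 -sum_nat_const_seq.
have count1 v : v \in W -> count_mem v W = 1 by move=> vW; rewrite count_uniq_mem ?vW.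
rewrite big_seq -(eq_bigr _ count1) -big_seq.
apply: (window_weight uW _ _ gap) => [P|v /count1->//].
by rewrite -size_filter -[leqRHS]size_filter uniq_leq_size ?filter_uniq // => v;
  rewrite !mem_filter => /andP[-> /WV].
Qed.

Lemma count_near_ge (T : Type) (bs : seq T) (gap : T -> nat) M h r : 0 < M ->
    r * \sum_(b <- bs) gap b <= size bs * M -> 4 * M <= r * h.+1 ->
  3 * size bs <= 4 * count (fun b => gap b <= h) bs.
Proof.
move=> M0 near Mr; have far : 4 * count (fun b => h < gap b) bs <= size bs.
  rewrite -(leq_pmul2r M0); apply: leq_trans near.
  apply: (@leq_trans (r * (h.+1 * count (fun b => h < gap b) bs))).
    by rewrite mulnA -mulnAC leq_mul2r Mr orbT.
  by rewrite leq_mul2l count_gt_markov orbT.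
have := count_predC (fun b => gap b <= h) bs.
by rewrite (eq_count (a1 := predC _) (fun b => esym (ltnNge _ _))); lia.
Qed.

(** * Values around many axes through the origin *)

(* Take [m] of order [sqrt (L / K)] and [r] of order [T / m]. *)
Lemma cover_tradeoff (K C : nat) : 0 < K -> exists C' : nat, forall L T, 0 < T ->
    (forall m r, 0 < m -> K * m ^ 2 < L -> 0 < r -> 4 * T <= r * m ->
       L <= C * r ^ 3 * m) ->
  L ^ 2 <= C' * T ^ 3.
Proof.
move=> K0; pose D := 125 * C.
exists (K ^ 2 + 4 * K * D + (4 * K * D ^ 2) ^ 2) => L T T0 cover.
have T3 : 0 < T ^ 3 by rewrite expn_gt0 T0.
have bounded B : L <= B -> B ^ 2 <= K ^ 2 + 4 * K * D + (4 * K * D ^ 2) ^ 2 ->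
    L ^ 2 <= (K ^ 2 + 4 * K * D + (4 * K * D ^ 2) ^ 2) * T ^ 3.
  move=> LB B_le; rewrite -[L ^ 2]muln1; apply: leq_mul T3.
  by apply: leq_trans B_le; rewrite leq_exp2r.
have [LK|KL] := leqP L K; first by apply: bounded LK _; rewrite -addnA leq_addr.
have ex_m : exists m, L <= K * m ^ 2 by exists L; nia.
case: (ex_minnP ex_m) => [[|[|j]]]; rewrite ?muln0 ?muln1 ?leqn0.
- by move/eqP=> L0; rewrite L0 in KL.
- by rewrite leqNgt KL.
pose m := j.+1; rewrite -/m => L_le m_min; have m0 : 0 < m by [].
have {m_min} m_lt : K * m ^ 2 < L.
  by rewrite ltnNge; apply/negP => /m_min; rewrite ltnn.
have {}L_le : L <= 4 * K * m ^ 2 by apply: leq_trans L_le _; rewrite /m; nia.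
pose r := 4 * T %/ m + 1; have r0 : 0 < r by rewrite /r addn1.
have r_ge : 4 * T <= r * m by rewrite /r addn1 ltnW // -ltn_divLR.
have r_le : r * m <= 4 * T + m by rewrite /r mulnDl mul1n leq_add2r leq_divM.
have balance t : m <= t -> T <= t -> L * m ^ 2 <= D * t ^ 3.
  move=> mt Tt; apply: (@leq_trans (C * (r * m) ^ 3)).
    apply: leq_trans (leq_mul (cover m r m0 m_lt r0 r_ge) (leqnn _)) _.
    by rewrite expnMn expnS [m ^ 3]expnS; lia.
  rewrite /D -mulnA [125 * _]mulnCA leq_mul2l -[125]/(5 ^ 3) -expnMn leq_exp2r //.
  by apply/orP; right; lia.
have [mT|Tm] := leqP m T.
  rewrite 2!mulnDl -addnA.
  apply: leq_trans (leq_addl _ _); apply: leq_trans (leq_addr _ _).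
  rewrite -mulnn; apply: leq_trans (leq_mul (leqnn L) L_le) _.
  by rewrite mulnCA -[leqRHS]mulnA leq_mul2l balance ?orbT.
have m_le : m <= D.
  have := balance m (leqnn m) (ltnW Tm).
  rewrite [m ^ 3]expnS mulnA leq_pmul2r ?expn_gt0 // => L_D.
  rewrite -(leq_pmul2r m0) mulnn; apply: leq_trans L_D.
  exact: leq_trans (leq_pmull _ K0) (ltnW m_lt).
apply: (bounded (4 * K * D ^ 2)); last exact: leq_addl.
by apply: leq_trans L_le _; rewrite leq_mul2l leq_exp2r // m_le orbT.
Qed.

Section Axes.
Variable R : realType.
Local Notation point := 'rV[R]_3.

Definition axis_gap (B : seq point) (c b p : point) : nat :=
  level_gap (values (axis_value b) B) (axis_value b c) (axis_value b p).

Lemma axes_ball_small (B G : seq point) c T h r :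
    uniq B -> (0 : point)%R \notin B ->
    {in B &, forall b b', b != b' -> b \x b' != 0%R} ->
    uniq G -> {subset G <= B} -> 0 < T ->
    {in G, forall p, r * \sum_(b <- B) axis_gap B c b p <= size B * T} ->
    4 * T <= r * h.+1 -> 1024 * 32 * h.*2.+1 ^ 2 < size B ->
  size G < 16 * h.*2.+1.
Proof.
move=> uB B0 indep uG GB T0 near Tr.
pose good b p := axis_gap B c b p <= h.
apply: (rich_points_lt (f := axis_value (R := R)) (good := good)) => //.
- move=> p q s /GB pB /GB qB /GB sB pq qs ps.
  rewrite -size_filter; apply: (@common_cylinders_le R p q s);
    rewrite ?indep ?filter_uniq // 1?eq_sym //.
  + by rewrite mem_filter negb_and B0 orbT.
  + by move=> b b'; rewrite !mem_filter => /andP[_ bB] /andP[_ b'B]; apply: indep.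
  + by move=> b; rewrite mem_filter => /andP[/andP[/eqP-> /eqP->]].
- move=> b bB.
  apply: (window_size (V := values (axis_value b) B) (c := axis_value b c)
    (values_uniq _ _)) => v /valuesP[p]; rewrite mem_filter => /andP[p_near pG] -> //.
  by rewrite mem_values // GB.
- move=> p pG; rewrite -(leq_pmul2l (ltn0Sn 1)) mulnA.
  apply: leq_trans (count_near_ge T0 (near p pG) Tr).
  by rewrite leq_mul2r orbT.
Qed.

Lemma axes_count_le : exists C : nat, forall (B : seq point) T,
    uniq B -> (0 : point)%R \notin B ->
    {in B &, forall b b', b != b' -> b \x b' != 0%R} ->
    {in B, forall b, size (values (axis_value b) B) <= T} ->
  size B ^ 2 <= C * T ^ 3.
Proof.
have [C1 cover] := level_cover R 3 2.
have [|C tradeoff] := @cover_tradeoff (4 * (1024 * 32)) (C1 * 32).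
  by rewrite !muln_gt0.
exists C => B T uB B0 indep leT.
have [->|] := posnP (size B); first by rewrite exp0n.
rewrite -has_predT => /hasP[b0 b0B _].
have T0 : 0 < T.
  apply: leq_trans (leT b0 b0B); rewrite -has_predT; apply/hasP.
  by exists (axis_value b0 b0); rewrite ?mem_values.
apply: tradeoff => // -[//|h] r _ h_lt r0 Tr.
have [b _|Z [ZB sZ near]] :=
    cover _ B (fun b => values (axis_value b) B) (@axis_value R) B r r0.
  exact: axis_value_poly_levels.
pose close c p := r * \sum_(b <- B) axis_gap B c b p <= size B * T.
have covered : size B <= \sum_(c <- Z) count (close c) B.
  apply: size_le_sum_cover => p /near[c cZ cp]; exists c => //.
  by apply: leq_trans cp _; rewrite -sum_nat_const_seq leq_sum_in.
have small c : count (close c) B <= 32 * h.+1.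
  apply: (@leq_trans (16 * h.*2.+1)); last by lia.
  rewrite -size_filter; apply/ltnW/(@axes_ball_small B _ c T h r) => //.
  - exact: filter_uniq.
  - by move=> p; rewrite mem_filter => /andP[].
  - by move=> p; rewrite mem_filter => /andP[].
  - by apply: leq_ltn_trans h_lt; nia.
apply: leq_trans covered _; apply: leq_trans (leq_sum _ (fun c _ => small c)) _.
rewrite sum_nat_const_seq; apply: leq_trans (leq_mul sZ (leqnn _)) _; lia.
Qed.

End Axes.

(** * A weak Dirac theorem *)

Local Open Scope ring_scope.

Lemma sumr_const_seq (F : pzRingType) (T : Type) (s : seq T) (P : pred T) (a : F) :
  \sum_(x <- s | P x) a = (count P s)%:R * a.
Proof. by rewrite big_const_seq iter_addr_0 -[LHS]mulr_natl. Qed.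

Lemma sum_inv_multiplicity (F : numFieldType) (T U : eqType) (f : T -> U) (s : seq T) :
  \sum_(x <- s) (count (fun y => f y == f x) s)%:R^-1 = (size (values f s))%:R :> F.
Proof.
rewrite (big_values f) -sum1_size natr_sum; apply: eq_big_seq => _ /valuesP[x xs ->].
rewrite (eq_bigr (fun=> (count (fun y => f y == f x) s)%:R^-1)) => [|y /eqP-> //].
rewrite sumr_const_seq divff // pnatr_eq0 -lt0n -has_count.
by apply/hasP; exists x.
Qed.

Lemma sum_sqr_counts (F : numFieldType) (T U : eqType) (f : T -> U) (s : seq T)
    (E : U -> F) :
  \sum_(v <- values f s) (count (fun x => f x == v) s)%:R ^+ 2 * E v =
  \sum_(x <- s) \sum_(y <- s) (f x == f y)%:R * E (f x).
Proof.
rewrite [RHS](big_values f); apply: eq_bigr => v _.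
rewrite (eq_bigr (fun=> (count (fun x => f x == v) s)%:R * E v)) => [|x /eqP->].
  by rewrite sumr_const_seq mulrA expr2.
rewrite -big_distrl /= -natr_sum -countE.
by congr (_%:R * _); apply: eq_count => y; apply: eq_sym.
Qed.

Section WeightedIncidences.
Variables (F : realFieldType) (T U V : eqType) (f : T -> U -> V).
Variables (A : seq T) (G : seq U) (good : T -> pred U) (wt : T -> V -> nat) (M L : nat).
Hypothesis wt_gt0 : {in A & G, forall a x, (0 < wt a (f a x))%N}.
Hypothesis M_gt0 : (0 < M)%N.
Hypothesis wt_sum : {in A, forall a,
  (\sum_(v <- values (f a) [seq x <- G | good a x]) wt a v <= M)%N}.
Hypothesis wt_pairs : {in G &, forall x y,
  \sum_(a <- A) (f a x == f a y)%:R / (wt a (f a x))%:R <=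
  (if x == y then L%:R else 1 : F)}.
Hypothesis uG : uniq G.

Local Notation value_count a v := (count (fun x => f a x == v) [seq x <- G | good a x]).

Lemma sum_weighted_pairs_le :
  \sum_(a <- A) \sum_(v <- values (f a) [seq x <- G | good a x])
    (value_count a v)%:R ^+ 2 / (wt a v)%:R
  <= (size G)%:R * ((size G)%:R + L%:R) :> F.
Proof.
pose term a x y : F := (f a x == f a y)%:R / (wt a (f a x))%:R.
have term0 a x y : 0 <= term a x y by rewrite mulr_ge0 // invr_ge0.
apply: (@le_trans _ _ (\sum_(a <- A) \sum_(x <- G) \sum_(y <- G) term a x y)).
  apply: ler_sum => a _; rewrite sum_sqr_counts big_filter big_mkcond.
  apply: ler_sum => x _; case: ifP => _; last by apply: sumr_ge0.
  by rewrite big_filter big_mkcond; apply: ler_sum => y _; case: ifP.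
rewrite exchange_big -[size G in leRHS]count_predT -sumr_const_seq.
rewrite big_seq [leRHS]big_seq; apply: ler_sum => x xG; rewrite exchange_big.
have le_term y : y \in G -> \sum_(a <- A) term a x y <= 1 + (y == x)%:R * L%:R.
  by move=> yG; apply: le_trans (wt_pairs xG yG) _; rewrite eq_sym;
    case: eqP => _; rewrite ?mul1r ?mul0r ?addr0 ?lerDr.
rewrite big_seq; apply: le_trans (ler_sum _ le_term) _; rewrite -big_seq.
rewrite big_split -big_distrl /= sumr_const_seq count_predT mulr1.
by rewrite -natr_sum -countE count_uniq_mem // xG mul1r.
Qed.

Lemma weighted_incidences_le :
  (2 * \sum_(a <- A) count (good a) G <= size A * size G + M * (size G + L))%N.
Proof.
have [/size0nil->|G0] := posnP (size G).
  by rewrite big1 // => a _.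
rewrite -(ler_nat F) natrM natrD !natrM natrD natr_sum.
set g : F := (size G)%:R; set m : F := M%:R.
have g0 : 0 < g by rewrite ltr0n.
have m0 : 0 < m by rewrite ltr0n.
pose th := g / m; have th0 : 0 < th by rewrite divr_gt0.
have amgm (x y : F) : 0 < y -> 2 * x <= th * y + th^-1 * (x ^+ 2 / y).
  move=> y0; rewrite -subr_ge0.
  have -> : th * y + th^-1 * (x ^+ 2 / y) - 2 * x = (th * y - x) ^+ 2 / (th * y).
    by field; rewrite !gt_eqF.
  by rewrite divr_ge0 ?sqr_ge0 // mulr_ge0 // ltW.
have point_le a : a \in A -> 2 * (count (good a) G)%:R <=
    th * m + th^-1 * \sum_(v <- values (f a) [seq x <- G | good a x])
      (value_count a v)%:R ^+ 2 / (wt a v)%:R.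
  move=> aA; rewrite -size_filter -(sum_count_values (f a)) natr_sum big_distrr /=.
  apply: (@le_trans _ _ (\sum_(v <- values (f a) [seq x <- G | good a x])
      (th * (wt a v)%:R + th^-1 * ((value_count a v)%:R ^+ 2 / (wt a v)%:R)))).
    rewrite big_seq [leRHS]big_seq; apply: ler_sum => _ /valuesP[x + ->].
    by rewrite mem_filter => /andP[_ xG]; apply: amgm; rewrite ltr0n wt_gt0.
  rewrite big_split -!big_distrr /= lerD2r ler_pM2l // -natr_sum ler_nat.
  exact: wt_sum.
have -> : (size A)%:R * g + m * (g + L%:R) =
    (size A)%:R * (th * m) + th^-1 * (g * (g + L%:R)).
  by rewrite /th; field; rewrite !gt_eqF.
rewrite big_distrr /= big_seq; apply: le_trans (ler_sum _ point_le) _.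
rewrite -big_seq big_split /= sumr_const_seq count_predT -big_distrr /=.
by rewrite lerD2l ler_pM2l ?invr_gt0 // sum_weighted_pairs_le.
Qed.

End WeightedIncidences.

Section Slopes.
Variables (R : realType) (T : eqType) (X Y : T -> R) (S : seq T).
Hypothesis X_inj : {in S &, injective X}.
Implicit Types (a c p q x : T).

Definition slope a x : R := (Y x - Y a) / (X x - X a).

Definition slopes a : seq R := [seq slope a x | x <- S & x != a].

Definition slope_gap c a p : nat :=
  level_gap [seq slope a x | x <- S] (slope a c) (slope a p).

Lemma slopeC a x : slope a x = slope x a.
Proof. by rewrite /slope -opprB -[X x - X a]opprB invrN mulrNN. Qed.

Lemma slopeP a x s : a \in S -> x \in S -> a != x ->
  (slope a x == s) = (Y x - Y a == s * (X x - X a)).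
Proof.
move=> aS xS ax; have nz : X x - X a != 0.
  by rewrite subr_eq0; apply: contra_neq ax => /(X_inj xS aS).
by rewrite -(inj_eq (mulIf nz)) /slope mulfVK.
Qed.

Lemma slope_trans a p q : a \in S -> p \in S -> q \in S ->
  a != p -> a != q -> p != q -> slope a p = slope a q -> slope p q = slope a p.
Proof.
move=> aS pS qS ap aq pq e; apply/eqP; rewrite slopeP //.
have /eqP e1 : Y p - Y a == slope a p * (X p - X a) by rewrite -slopeP.
have /eqP e2 : Y q - Y a == slope a p * (X q - X a) by rewrite e -slopeP.
have -> : Y q - Y p = (Y q - Y a) - (Y p - Y a) by ring.
by rewrite e1 e2; apply/eqP; ring.
Qed.

Lemma count_slopes a s :
  count_mem s (slopes a) = count (fun x => (slope a x == s) && (x != a)) S.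
Proof. by rewrite /slopes count_map count_filter. Qed.

Variables (A G : seq T) (c : T) (h k r L : nat).
Hypotheses (uA : uniq A) (AS : {subset A <= S}).
Hypotheses (uG : uniq G) (GS : {subset G <= S}).
Hypothesis GA : {in G, forall p, p \notin A}.
Hypothesis poor : {in S &, forall a x, a != x ->
  (count_mem (slope a x) (slopes a) <= k)%N}.
Hypothesis few_slopes : {in G, forall p, (size (undup (slopes p)) <= L)%N}.

Lemma centre_neq : {in A & G, forall a p, a != p}.
Proof. by move=> a p aA pG; apply: contraNneq (GA pG) => <-. Qed.

Lemma count_centres_le a p : a \in A -> p \in G ->
  (count (fun a' => slope p a' == slope p a) A <= count_mem (slope a p) (slopes a))%N.
Proof.
move=> aA pG; have [[aS pS] ap] := (AS aA, GS pG, centre_neq aA pG).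
rewrite count_slopes -!size_filter; set line := [seq a' <- A | _].
have a_line : a \in line by rewrite mem_filter eqxx.
have -> : size line = size (p :: rem a line).
  by rewrite /= (size_rem a_line) prednK //; case: (line) a_line.
apply: uniq_leq_size.
  rewrite /= rem_uniq ?filter_uniq // andbT; apply: contra (GA pG) => /mem_rem.
  by rewrite mem_filter => /andP[].
move=> x; rewrite inE => /predU1P[->|]; first by rewrite mem_filter eqxx pS eq_sym ap.
rewrite mem_rem_uniq ?filter_uniq // inE [x \in line]mem_filter.
move=> /and3P[xa /eqP px xA].
rewrite mem_filter xa AS // !andbT [slope a p]slopeC; apply/eqP.
by apply: (slope_trans pS aS (AS xA)); rewrite ?px // eq_sym // centre_neq.
Qed.

Lemma centre_slope_count_gt0 : {in A & G, forall a p,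
  (0 < count_mem (slope a p) (slopes a))%N}.
Proof.
move=> a p aA pG; apply: leq_trans (count_centres_le aA pG); rewrite -has_count.
by apply/hasP; exists a => /=.
Qed.

Lemma sum_inv_slope_count : {in G &, forall p q,
  \sum_(a <- A) (slope a p == slope a q)%:R / (count_mem (slope a p) (slopes a))%:R <=
  (if p == q then L%:R else 1) :> R}.
Proof.
move=> p q pG qG; have [pS qS] := (GS pG, GS qG).
have inv_le a : a \in A -> (count_mem (slope a p) (slopes a))%:R^-1 <=
    (count (fun a' => slope p a' == slope p a) A)%:R^-1 :> R.
  move=> aA; rewrite lef_pV2 ?posrE ?ltr0n ?centre_slope_count_gt0 //.
    by rewrite ler_nat; apply: count_centres_le.
  by rewrite -has_count; apply/hasP; exists a => /=.
have [<-|pq] := eqVneq p q.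
  apply: (@le_trans _ _ (size (values (slope p) A))%:R).
    rewrite -sum_inv_multiplicity big_seq [leRHS]big_seq; apply: ler_sum => a aA.
    by rewrite eqxx mul1r inv_le.
  rewrite ler_nat; apply: leq_trans (few_slopes pG).
  apply: uniq_leq_size (values_uniq _ _) _ => _ /valuesP[a aA ->].
  by rewrite mem_undup; apply: map_f; rewrite mem_filter centre_neq ?AS.
pose m := count (fun a => slope p a == slope p q) A.
apply: (@le_trans _ _ (\sum_(a <- A) (slope p a == slope p q)%:R * m%:R^-1)).
  rewrite big_seq [leRHS]big_seq; apply: ler_sum => a aA.
  have [ap_aq|_] := eqVneq (slope a p) (slope a q); last first.
    by rewrite mul0r mulr_ge0 // invr_ge0.
  have pa_pq : slope p a = slope p q.
    by rewrite slopeC (slope_trans (AS aA) pS qS _ _ pq ap_aq) ?centre_neq.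
  by rewrite pa_pq eqxx !mul1r; apply: le_trans (inv_le a aA) _; rewrite pa_pq.
rewrite -big_distrl /= -natr_sum -countE -/m.
have [->|m0] := posnP m; first by rewrite mul0r.
by rewrite divff // pnatr_eq0 -lt0n.
Qed.

Lemma dirac_ball_small : (0 < h.*2 + k)%N ->
    {in G, forall p, (r * \sum_(a <- A) slope_gap c a p <= size A * size S)%N} ->
    (4 * size S <= r * h.+1)%N -> (4 * (h.*2 + k) <= size A)%N ->
  (size G <= L)%N.
Proof.
move=> hk0 near Sr hkA; have [/size0nil-> //|G0] := posnP (size G).
pose good a p := (slope_gap c a p <= h)%N.
have wt_sum : {in A, forall a, (\sum_(v <- values (slope a) [seq p <- G | good a p])
    count_mem v (slopes a) <= h.*2 + k)%N}.
  move=> a aA.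
  apply: (window_weight (V := [seq slope a x | x <- S]) (c := slope a c)) => [|P|v|v].
  - exact: values_uniq.
  - by rewrite /slopes !count_map count_filter; apply: sub_count => x /andP[].
  - move=> /valuesP[p]; rewrite mem_filter => /andP[_ pG] ->.
    exact: poor (AS aA) (GS pG) (centre_neq aA pG).
  - by move=> /valuesP[p]; rewrite mem_filter => /andP[gp _] ->.
have upper := weighted_incidences_le centre_slope_count_gt0 hk0 wt_sum
  sum_inv_slope_count uG.
have lower : (3 * size A * size G <= 4 * \sum_(a <- A) count (good a) G)%N.
  rewrite double_count big_distrr /= mulnC -sum_nat_const_seq.
  apply: leq_sum_in => p pG.
  by apply: count_near_ge (near p pG) Sr; case: (S) (GS pG).
have A0 : (0 < size A)%N by apply: leq_trans hkA; rewrite muln_gt0.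
rewrite -(leq_pmul2l A0); move: upper lower hkA.
move: (\sum_(a <- A) _)%N (size A) (size G) (h.*2 + k)%N => I a g m; nia.
Qed.

End Slopes.

Lemma split_increasing (R : realType) (T : eqType) (X : T -> R) (S : seq T) :
    uniq S -> {in S &, injective X} ->
  exists A P, [/\ perm_eq (A ++ P) S, size A = (size S)./2 &
    {in A & P, forall a p, X a < X p}].
Proof.
move=> uS X_inj; pose S' := sort (fun x y => X x <= X y) S.
have permS : perm_eq S' S by rewrite perm_sort.
exists (take (size S)./2 S'), (drop (size S)./2 S'); split.
- by rewrite cat_take_drop.
- by rewrite size_takel // (perm_size permS) -divn2 leq_div.
move=> a p aA pP; rewrite lt_neqAle; apply/andP; split.
  have [aS pS] : a \in S /\ p \in S.
    by rewrite -!(perm_mem permS) (mem_take aA) (mem_drop pP).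
  have : uniq S' by rewrite (perm_uniq permS).
  rewrite -{1}(cat_take_drop (size S)./2 S') cat_uniq => /and3P[_ /hasPn disj _].
  by apply: contraNneq (disj p pP) => /(X_inj _ _ aS pS) <-; apply: aA.
have : pairwise (fun x y => X x <= X y) S'.
  rewrite -sorted_pairwise; last by move=> u v w; apply: le_trans.
  by apply: sort_sorted => u v; apply: le_total.
rewrite -(cat_take_drop (size S)./2 S') pairwise_cat => /and3P[/allrelP le_X _ _].
exact: le_X.
Qed.

Section WeakDirac.
Variables (R : realType) (n : nat).
Local Notation point := 'rV[R]_n.

Lemma slope_poly_levels (X Y : point -> R) (P : seq point) a :
    poly_fun 1 X -> poly_fun 1 Y -> {in P, forall p, X a < X p} ->
  poly_levels 1 P (slope X Y a).
Proof.
move=> pX pY ltX th; exists (fun p => (Y p + - th * X p) + (th * X a - Y a)).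
  apply: poly_funD; last exact: poly_fun_cst.
  by apply: poly_funD => //; apply: poly_funZ.
move=> p pP; have Xp : 0 < X p - X a by rewrite subr_gt0 ltX.
rewrite -[RHS]mulr1 -(gtr0_sg Xp) -sgrM; congr Num.sg.
by rewrite mulrBl /slope divfK ?gt_eqF //; ring.
Qed.

(* The left half of the points serves as centres of pencils and the right half
   as points, so that the slopes are monotone along each pencil. *)
Lemma weak_dirac : exists C : nat, forall (X Y : point -> R) (S : seq point),
    poly_fun 1 X -> poly_fun 1 Y ->
    uniq S -> {in S &, injective X} -> (64 <= size S)%N ->
    {in S &, forall a x, a != x ->
      (count_mem (slope X Y a x) (slopes X Y S a) <= size S %/ 64)%N} ->
  exists2 a, a \in S & (size S <= C * size (undup (slopes X Y S a)))%N.
Proof.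
have [C cover] := level_cover R n 1.
exists (2 * (C * 256 ^ n))%N => X Y S pX pY uS X_inj S64 poor.
have S0 : S != [::] by case: S S64 {uS X_inj poor}.
have [a aS amax] := seq_argmax (fun a => size (undup (slopes X Y S a))) S0.
exists a => //; set L := size (undup (slopes X Y S a)).
have [A [P [permS sizeA ltX]]] := split_increasing uS X_inj.
have /and3P[uA /hasPn PA uP] : uniq A && (~~ has (mem A) P && uniq P).
  by rewrite -cat_uniq (perm_uniq permS).
have AS : {subset A <= S} by move=> x xA; rewrite -(perm_mem permS) mem_cat xA.
have PS : {subset P <= S} by move=> x xP; rewrite -(perm_mem permS) mem_cat xP orbT.
have [x xA|Z [ZP sZ near]] := cover _ A (fun a => [seq slope X Y a x | x <- S])
    (slope X Y) P 256 isT.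
  by apply: slope_poly_levels => // p pP; apply: ltX.
pose close c p := (256 * \sum_(x <- A) slope_gap X Y S c x p <= size A * size S)%N.
have covered : (size P <= \sum_(c <- Z) count (close c) P)%N.
  apply: size_le_sum_cover => p /near[c cZ cp]; exists c => //.
  apply: leq_trans cp _; rewrite -sum_nat_const_seq; apply: leq_sum => x _.
  by rewrite size_map.
have small c : (count (close c) P <= L)%N.
  rewrite -size_filter.
  apply: (dirac_ball_small (X := X) (Y := Y) (S := S) (c := c) (h := size S %/ 64)
    (k := size S %/ 64) (r := 256) X_inj uA AS) => //.
  - exact: filter_uniq.
  - by move=> p; rewrite mem_filter => /andP[_ /PS].
  - by move=> p; rewrite mem_filter => /andP[_ /PA].
  - by move=> p; rewrite mem_filter => /andP[_ /PS/amax].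
  - by rewrite addn_gt0 divn_gt0 // S64 orbT.
  - by move=> p; rewrite mem_filter => /andP[].
  - by move: (size S) => m; clear; lia.
  - by rewrite sizeA; move: (size S) => m; clear; lia.
have S_le : (size S <= 2 * size P)%N.
  have := perm_size permS; rewrite size_cat sizeA.
  by move: (size S) (size P) => m m'; clear; lia.
apply: leq_trans S_le _; rewrite -mulnA leq_mul2l; apply: leq_trans covered _.
apply: leq_trans (leq_sum _ (fun c _ => small c)) _.
by rewrite sum_nat_const_seq leq_mul2r sZ orbT.
Qed.

End WeakDirac.

(** * Areas *)

Section Areas.
Variable R : realType.
Local Notation point := 'rV[R]_3.
Implicit Types (S M : seq point) (a b c p x y : point).

(* Four times the square of the area of the triangle [a b x]. *)
Definition area_sq a b x : R := axis_value (b - a) (x - a).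

Definition area_sqs S a b : seq R :=
  values (area_sq a b) [seq x <- S | area_sq a b x != 0].

Lemma area_sq_eq0 a b x : (area_sq a b x == 0) = ((b - a) \x (x - a) == 0).
Proof. exact: axis_value_eq0. Qed.

Lemma area_sq_gt0 a b x : (0 < area_sq a b x) = (area_sq a b x != 0).
Proof. by rewrite lt0r dot_ge0 andbT. Qed.

Lemma area3E a b x : area3 a b x = Num.sqrt (area_sq a b x) / 2.
Proof. by []. Qed.

(* Generic projections of the points to the plane preserve the collinearity of
   triples. *)
Lemma exists_generic_slopes S : exists e f : point,
  {in S &, injective (dot e)} /\
  {in S & &, forall a x y, x != a -> y != a ->
    (slope (dot e) (dot f) a x == slope (dot e) (dot f) a y) =
    ((x - a) \x (y - a) == 0)}.
Proof.
pose us := [seq u <- [seq x - a | x <- S, a <- S] | u != 0].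
have usP x a : x \in S -> a \in S -> x != a -> x - a \in us.
  move=> xS aS xa; rewrite mem_filter subr_eq0 xa /=.
  exact: (allpairs_f (fun x a : point => x - a)).
have [|e eP] := @exists_nonorthogonal R 3 us; first by rewrite mem_filter eqxx.
pose ws := [seq w <- [seq (u \x v) \x e | u <- us, v <- us] | w != 0].
have [|f fP] := @exists_nonorthogonal R 3 ws; first by rewrite mem_filter eqxx.
exists e, f; split=> [x y xS yS exy|a x y aS xS yS xa ya].
  apply/eqP; apply: contraT => xy.
  by have := eP _ (usP x y xS yS xy); rewrite dotBr exy subrr eqxx.
have uus := usP x a xS aS xa; have vus := usP y a yS aS ya.
rewrite /slope -!dotBr eqr_div ?eP //; set u := x - a in uus *; set v := y - a in vus *.
have -> : (dot f u * dot e v == dot f v * dot e u) = (dot f ((u \x v) \x e) == 0).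
  by rewrite -subr_eq0 -oppr_eq0 !dotE !coordE; congr (_ == _); ring.
apply/eqP/eqP => [|->]; last by rewrite cross0v /dot big1 // => i _; rewrite mxE mulr0.
apply: contra_eq => uv0; apply: fP; rewrite mem_filter.
rewrite (allpairs_f (fun u v => (u \x v) \x e)) // andbT.
apply: contra (eP u uus) => /(cross_eq0P _ uv0)[k ->].
by rewrite !dotE !coordE; apply/eqP; ring.
Qed.

Lemma line_points_le S M a x p : uniq M -> {subset M <= S} ->
    (p - a) \x (x - a) != 0 ->
    {in M, forall y, y != a /\ (x - a) \x (y - a) = 0} ->
  (size M <= 2 * size (area_sqs S a p))%N.
Proof.
move=> uM MS px line.
have xa0 : x - a != 0 by apply: contra_neq px => ->; apply: crossv0.
have paramP y : y \in M -> exists2 t, y = t *: (x - a) + a & t != 0.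
  move=> /line[ya /eqP/(cross_eq0P _ xa0)[t yt]]; exists t; first by rewrite -yt subrK.
  by apply: contra_neq ya => t0; move/eqP: yt; rewrite t0 scale0r subr_eq0 => /eqP.
have areaE t : area_sq a p (t *: (x - a) + a) = t ^+ 2 * area_sq a p x.
  by rewrite /area_sq addrK axis_valueZr.
have px0 : area_sq a p x != 0 by rewrite area_sq_eq0.
apply: (@leq_trans (size (values (area_sq a p) M) * 2)).
  apply: size_le_values => y /paramP[t -> _]; rewrite -size_filter.
  apply: (@uniq_leq_size _ _ [:: t *: (x - a) + a; (- t) *: (x - a) + a]).
    exact: filter_uniq.
  move=> z; rewrite mem_filter => /andP[/eqP + zM]; have [s -> _] := paramP z zM.
  rewrite !areaE => /(mulIf px0)/eqP; rewrite eqf_sqr !inE.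
  by case/orP => /eqP->; rewrite eqxx ?orbT.
rewrite mulnC leq_mul2l /=.
apply: uniq_leq_size (values_uniq _ _) _ => _ /valuesP[y yM ->].
apply: mem_values; rewrite mem_filter MS // andbT.
by have [t -> t0] := paramP y yM; rewrite areaE mulf_neq0 // expf_neq0.
Qed.

End Areas.

Local Open Scope fset_scope.
Local Open Scope ring_scope.

Section PointSets.
Variable R : realType.
Local Notation point := 'rV[R]_3.
Implicit Types (S : {fset point}) (a b c x : point).

Lemma exists_off_line S a b : ~ collinear S -> a != b ->
  exists2 x, x \in S & (b - a) \x (x - a) != 0.
Proof.
move=> nc ab; have d0 : b - a != 0 by rewrite subr_eq0 eq_sym.
have [/hasP[x xS xP]|/hasPn line] :=
  boolP (has (fun x => (b - a) \x (x - a) != 0) S); first by exists x.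
case: nc; exists a, (b - a); split=> // x /line; rewrite negbK.
by move=> /(cross_eq0P _ d0)[t e]; exists t; rewrite -e addrC subrK.
Qed.

Definition areas_bounded S (T : nat) : Prop :=
  {in S &, forall a b, a != b -> (size (area_sqs S a b) <= T)%N}.

Lemma exists_max_areas S : (1 < #|` S|)%N ->
  exists a b, [/\ a \in S, b \in S, a != b & areas_bounded S (size (area_sqs S a b))].
Proof.
move=> S2; pose pairs := [seq ab <- [seq (a, b) | a <- S, b <- S] | ab.1 != ab.2].
have pairsP a b : (a, b) \in pairs = [&& a != b, a \in S & b \in S].
  rewrite mem_filter; congr (_ && _).
  apply/allpairsP/andP => [[[x y] [/= xS yS [-> ->]]] //|].
  by move=> [aS bS]; exists (a, b).
have pairs0 : pairs != [::].
  have : exists a b, [&& a != b, a \in S & b \in S].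
    have S_uniq := fset_uniq S; case E : (enum_fset S) S2 => [|a [|b s]] // _.
    exists a, b; move: S_uniq; rewrite E /= inE negb_or => /andP[/andP[ab _] _].
    have mem_S y : (y \in S) = (y \in [:: a, b & s]) by rewrite -E.
    by rewrite ab !mem_S !inE !eqxx orbT.
  by move=> [a [b]]; rewrite -pairsP; case: (pairs).
have [[a b] + max_ab] := seq_argmax (fun ab => size (area_sqs S ab.1 ab.2)) pairs0.
rewrite pairsP => /and3P[ab aS bS]; exists a, b; split=> // c d cS dS cd.
by apply: (max_ab (c, d)); rewrite pairsP cd cS.
Qed.

Lemma areas_bounded_gt0 S T : (1 < #|` S|)%N -> ~ collinear S -> areas_bounded S T ->
  (0 < T)%N.
Proof.
move=> /exists_max_areas[a [b [aS bS ab _]]] nc leT.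
apply: leq_trans (leT a b aS bS ab); have [x xS abx] := exists_off_line nc ab.
rewrite -has_predT; apply/hasP; exists (area_sq a b x) => //.
by apply: mem_values; rewrite mem_filter area_sq_eq0 abx.
Qed.

Section GenericSlopes.
Variables (S : {fset point}) (e f : point) (T : nat).
Local Notation slope := (slope (dot e) (dot f)).
Local Notation slopes := (slopes (dot e) (dot f) S).
Hypothesis slopeE : {in S & &, forall a x y, x != a -> y != a ->
  (slope a x == slope a y) = ((x - a) \x (y - a) == 0)}.
Hypothesis leT : areas_bounded S T.

Lemma rich_slope_le a x : ~ collinear S -> a \in S -> x \in S -> a != x ->
  (count_mem (slope a x) (slopes a) <= 2 * T)%N.
Proof.
move=> nc aS xS ax; have [p pS px] := exists_off_line nc ax.
have {}px : (p - a) \x (x - a) != 0 by rewrite crossC oppr_eq0.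
have ap : a != p by apply: contra_neq px => <-; rewrite subrr cross0v.
rewrite count_slopes -size_filter; set M := [seq y <- S | _].
have MP y : y \in M -> [/\ slope a x = slope a y, y != a & y \in S].
  by rewrite mem_filter => /andP[/andP[/eqP-> ->] ->].
have : (size M <= 2 * size (area_sqs S a p))%N.
  apply: (line_points_le (x := x)) => //; first exact: filter_uniq (fset_uniq S).
    by move=> y /MP[].
  move=> y /MP[xy ya yS]; split=> //; apply/eqP.
  by rewrite -slopeE // 1?eq_sym // xy.
by move/leq_trans; apply; rewrite leq_mul2l /=; apply: leT.
Qed.

Lemma axes_of_slopes a : a \in S -> exists B : seq point,
  [/\ uniq B, size B = size (undup (slopes a)), 0 \notin B,
      {in B &, forall u v, u != v -> u \x v != 0} &
      {in B, forall u, (size (values (axis_value u) B) <= T.+1)%N}].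
Proof.
move=> aS.
have repP (s : R) : exists x, s \in slopes a -> [/\ x \in S, x != a & slope a x = s].
  have [/mapP[x]|_] := boolP (s \in slopes a); last by exists a.
  by rewrite mem_filter => /andP[xa xS] ->; exists x.
have [rep {}repP] := choice repP.
pose axis s := rep s - a; exists [seq axis s | s <- undup (slopes a)].
have {}repP s : s \in undup (slopes a) ->
    [/\ rep s \in S, rep s != a & slope a (rep s) = s].
  by rewrite mem_undup; apply: repP.
split.
- rewrite map_inj_in_uniq ?undup_uniq // => s t /repP[_ _ es] /repP[_ _ et] /addIr st.
  by rewrite -es st.
- by rewrite size_map.
- by apply/mapP => -[s /repP[_ sa _] /esym/eqP]; rewrite subr_eq0; apply/negP.
- move=> _ _ /mapP[s /repP[sS sa es] ->] /mapP[t /repP[tS ta et] ->] st.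
  by rewrite -slopeE // es et; apply: contra_neq st => ->.
move=> _ /mapP[s /repP[sS sa _] ->]; have as_ : a != rep s by rewrite eq_sym.
apply: (@leq_trans (size (0 :: area_sqs S a (rep s)))); last by rewrite /= ltnS leT.
apply: uniq_leq_size (values_uniq _ _) _ => _ /valuesP[_ /mapP[t /repP[tS _ _] ->] ->].
rewrite inE; have [//|nz] := eqVneq.
by apply: mem_values; rewrite mem_filter nz.
Qed.

End GenericSlopes.

Lemma points_le_areas : exists C : nat, forall S T,
    (1 < #|` S|)%N -> ~ collinear S -> areas_bounded S T ->
  (#|` S| ^ 2 <= C * T ^ 3)%N.
Proof.
have [C1 axes] := axes_count_le R.
have [C2 dirac] := weak_dirac R 3.
exists (128 ^ 2 + C2 ^ 2 * (C1 * 2 ^ 3))%N => S T S2 nc leT.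
have T0 := areas_bounded_gt0 S2 nc leT.
have linear : (#|` S| <= 128 * T)%N ->
    (#|` S| ^ 2 <= (128 ^ 2 + C2 ^ 2 * (C1 * 2 ^ 3)) * T ^ 3)%N.
  move=> S_le; rewrite mulnDl; apply: leq_trans (leq_addr _ _).
  apply: (@leq_trans ((128 * T) ^ 2)%N); first by rewrite leq_exp2r.
  by rewrite expnMn leq_mul2l leq_pexp2l ?orbT.
have [S64|S64] := ltnP #|` S| 64.
  by apply: linear; apply: leq_trans (ltnW S64) _; lia.
have [e [f [e_inj slopeE]]] := exists_generic_slopes S.
pose rich a x := (#|` S| %/ 64 <
  count_mem (slope (dot e) (dot f) a x) (slopes (dot e) (dot f) S a))%N.
have [[a [x [aS xS ax ax_rich]]]|poor] :=
    pselect (exists a x, [/\ a \in S, x \in S, a != x & rich a x]).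
  have := leq_trans ax_rich (rich_slope_le slopeE leT nc aS xS ax).
  by rewrite ltn_divLR // => /ltnW S_le; apply: linear; lia.
have [|a aS S_le] := dirac (dot e) (dot f) S (poly_fun_dot e) (poly_fun_dot f)
    (fset_uniq S) e_inj S64.
  move=> a x aS xS ax; rewrite leqNgt; apply/negP => ax_rich.
  by apply: poor; exists a, x.
have [B [uB sizeB B0 indep axes_le]] := axes_of_slopes slopeE leT aS.
have := axes B T.+1 uB B0 indep axes_le; rewrite sizeB => dirs_le.
rewrite mulnDl; apply: leq_trans (leq_addl _ _).
apply: (@leq_trans ((C2 * size (undup (slopes (dot e) (dot f) S a))) ^ 2)%N).
  by rewrite leq_exp2r.
rewrite expnMn -[leqRHS]mulnA leq_mul2l; apply/orP; right; apply: leq_trans dirs_le _.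
rewrite -[leqRHS]mulnA leq_mul2l -expnMn leq_exp2r // mul2n -addnn -[leqLHS]addn1.
by rewrite leq_add2l T0 orbT.
Qed.

Lemma area_sqs_triangles S a b : a \in S -> b \in S -> a != b ->
  exists C : {fset {fset point}},
    [/\ forall T, T \in C -> [/\ triangle S T, a \in T & b \in T],
        forall T, T \in C -> 0 < area T,
        forall T1 T2, T1 \in C -> T2 \in C -> T1 <> T2 -> area T1 <> area T2
      & #|` C| = size (area_sqs S a b)].
Proof.
move=> aS bS ab; set V := area_sqs S a b.
have repP (v : R) : exists x, v \in V ->
    [/\ x \in S, area_sq a b x = v & area_sq a b x != 0].
  have [/valuesP[x]|_] := boolP (v \in V); last by exists a.
  by rewrite mem_filter => /andP[nz xS] ->; exists x.
have [rep {}repP] := choice repP; pose tri v := [fset a; b; rep v].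
have triP v : v \in V -> [/\ triangle S (tri v), area (tri v) = Num.sqrt v / 2 & 0 < v].
  move=> /repP[xS xv nz].
  have [ax bx] : a != rep v /\ b != rep v.
    rewrite area_sq_eq0 in nz; split; apply: contra_neq nz => <-.
      by rewrite subrr crossv0.
    exact: crossvv.
  split; last by rewrite -xv area_sq_gt0.
    split; first by apply/fsubsetP => y; rewrite !inE -orbA => /or3P[]/eqP->.
    by rewrite /tri fsetUC cardfsU1 cardfs2 !inE negb_or ab ![rep v == _]eq_sym ax bx.
  by rewrite area_fset3 // area3E xv.
have area_inj : {in V &, injective (fun v => area (tri v))}.
  move=> v w /triP[_ av v0] /triP[_ aw w0]; rewrite av aw => /mulIf.
  by rewrite invr_eq0 pnatr_eq0 => /(_ isT)/eqP; rewrite eqr_sqrt ?ltW // => /eqP.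
exists [fset T in [seq tri v | v <- V]]; split.
- move=> T; rewrite inE /= => /mapP[v /triP[tv _ _] ->].
  by split=> //; rewrite !inE eqxx ?orbT.
- move=> T; rewrite inE /= => /mapP[v /triP[_ av v0] ->].
  by rewrite av divr_gt0 // sqrtr_gt0.
- move=> T1 T2; rewrite !inE /= => /mapP[v vV ->] /mapP[w wV ->] vw eq_area.
  by apply: vw; rewrite (area_inj v w).
- rewrite card_fseq undup_id ?size_map //.
  rewrite map_inj_in_uniq ?values_uniq // => v w vV wV vw.
  exact: (area_inj v w vV wV (congr1 (@area R) vw)).
Qed.

End PointSets.

Lemma powR_two_thirds_le (R : realType) (x y : R) : 0 <= x -> 0 <= y ->
  x ^+ 2 <= y ^+ 3 -> x `^ (2%:R / 3%:R) <= y.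
Proof.
move=> x0 y0; have <- : (x `^ (2%:R / 3%:R)) ^+ 3 = x ^+ 2.
  by rewrite -powR_mulrn ?powR_ge0 // -powRrM divfK ?pnatr_eq0 // powR_mulrn.
by rewrite ler_pXn2r ?nnegrE ?powR_ge0.
Qed.

Lemma beta_ge1 (R : realType) (c : R) (n : nat) : 1 <= beta c n.
Proof. by rewrite /beta -expR0 ler_expR powR_ge0. Qed.

Theorem theorem12 (R : realType) :
  exists c1 c2 : R, 0 < c1 /\ 0 < c2 /\
    forall (n : nat) (S : {fset 'rV[R]_3}),
      (3 <= n)%N -> #|` S| = n -> ~ collinear S ->
      exists (a b : 'rV[R]_3) (C : {fset {fset 'rV[R]_3}}),
        [/\ a \in S, b \in S & a != b] /\
        [/\ forall T, T \in C -> [/\ triangle S T, a \in T & b \in T],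
            forall T, T \in C -> 0 < area T,
            forall T1 T2, T1 \in C -> T2 \in C -> T1 <> T2 ->
              area T1 <> area T2
          & c1 * n%:R `^ (2%:R / 3%:R) / beta c2 n <= #|` C|%:R].
Proof.
have [K points_le] := points_le_areas R.
exists (K.+1%:R^-1), 1; rewrite invr_gt0 ltr0n; do 2!split=> //.
move=> n S n3 Sn nc; have S2 : (1 < #|` S|)%N by rewrite Sn ltnW.
have [a [b [aS bS ab max_ab]]] := exists_max_areas S2.
have [C [C_tri C_pos C_dist C_size]] := area_sqs_triangles aS bS ab.
exists a, b, C; do 2!split=> //; have := points_le S _ S2 nc max_ab.
rewrite Sn C_size; set m := size _ => n_le.
have nK : n%:R `^ (2%:R / 3%:R) <= K.+1%:R * m%:R :> R.
  apply: powR_two_thirds_le; rewrite ?mulr_ge0 //.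
  rewrite -natrM -!natrX ler_nat.
  apply: leq_trans n_le _; rewrite expnMn leq_mul2r; apply/orP; right.
  by apply: leq_trans (leqnSn K) _; rewrite -[leqLHS]expn1 leq_pexp2l.
have b1 := beta_ge1 (1 : R) n.
rewrite ler_pdivrMr ?(lt_le_trans ltr01) // mulrC ler_pdivrMr ?ltr0n //.
by apply: le_trans nK _; rewrite mulrC -mulrA ler_wpM2l // ler_peMl.
Qed.
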